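(* Let $\mathcal{G} = \{(y_a,b_a) \mid a \in A\}$ be a finite subset of $\mathbb{Z}\wr\mathbb{Z}$ indexed by a finite set $A$, and let $I = \{a \in A \mid b_a > 0\}$, $J = \{a \in A\mid b_a<0\}$, $K = \{a\in A\mid b_a = 0\}$. Suppose $I \neq \emptyset$ and $J \neq\emptyset$. Let $d = \gcd(\{b_a \mid a \in I\cup J\})$, and let $h_{(i,j),m}\in\mathbb{Q}(X)$ and $y_{k,m}\in\mathbb{Q}[X^{\pm}]$ ($(i,j)\in I\times J$, $k\in K$, $0\le m\le d-1$) be as defined in the context. Then the semigroup $\langle\mathcal{G}\rangle$ is a group if and only if there exist a double-full set $S\subset I\times J$ and polynomials $f_S, f_K, f_{(i,j)}, f_k\in\mathbb{R}_{\ge0}[X^{\pm}]^*$ for $(i,j)\in S$, $k\in K$, that satisfy the following three conditions: (i) $\sum_{(i,j)\in S} f_{(i,j)} h_{(i,j),m} + \sum_{k\in K} f_k y_{k,m} = 0$ for $m=0,\ldots,d-1$, and $f_S = \sum_{(i,j)\in S} f_{(i,j)}$, $f_K=\sum_{k\in K} f_k$; (ii) $\deg_+(f_S)+1\ge \deg_+(f_K)$; (iii) $\deg_-(f_S)\le\deg_-(f_K)$.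
   Context: $\mathbb{Z}\wr\mathbb{Z}$ is the group of pairs $(y,b)$ with $y$ in the Laurent polynomial ring $\mathbb{Z}[X^{\pm}]$ and $b\in\mathbb{Z}$, with multiplication $(y,b)\cdot(y',b') = (y+X^b y', b+b')$ and neutral element $(0,0)$. $\langle\mathcal{G}\rangle$ is the semigroup generated by $\mathcal{G}$ (all products of non-empty finite sequences of elements of $\mathcal{G}$). A subset $S\subset I\times J$ is double-full if for every $i\in I$ there is $j\in J$ with $(i,j)\in S$, and for every $j\in J$ there is $i\in I$ with $(i,j)\in S$. For $(i,j)\in I\times J$ put $h_{(i,j)} = \frac{y_i}{1 + X^d + \cdots + X^{b_i - d}} + \frac{y_j}{X^{-d} + X^{-2d} + \cdots + X^{-|b_j|}} \in \mathbb{Q}(X)$. Since the denominators lie in $\mathbb{Q}[X^{\pm d}]$ (Laurent polynomials in $X^d$), there are $h_{(i,j),0},\dots,h_{(i,j),d-1}\in\mathbb{Q}(X)$ with $h_{(i,j)} = \sum_{m=0}^{d-1} h_{(i,j),m}(X^d)\cdot X^m$; similarly, for $k\in K$, there are $y_{k,0},\dots,y_{k,d-1}\in\mathbb{Q}[X^{\pm}]$ with $y_k=\sum_{m=0}^{d-1} y_{k,m}(X^d)\cdot X^m$. $\mathbb{R}_{\ge0}[X^{\pm}]$ is the set of Laurent polynomials with non-negative real coefficients and $\mathbb{R}_{\ge0}[X^{\pm}]^* = \mathbb{R}_{\ge0}[X^{\pm}]\setminus\{0\}$. For a non-zero Laurent polynomial $f=\sum_{i=p}^q a_iX^i$ with $a_p,a_q\ne0$,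 $\deg_-(f)=p$ and $\deg_+(f)=q$; moreover $\deg_-(0)=+\infty$ and $\deg_+(0)=-\infty$.
   Formalization: The polynomial f_K is required to be non-zero only when K is non-empty; when K is empty, f_K is the empty sum 0, and the statement as written would fail, e.g. for {(0,1),(0,-1)}. *)

(* Defs.v *)
From HB Require Import structures.
From mathcomp Require Import all_boot all_order all_algebra finmap.
From mathcomp Require Import fraction generic_quotient.
From mathcomp Require Export monalg.
From mathcomp Require Import reals constructive_ereal.

Set Implicit Arguments.
Unset Strict Implicit.
Unset Printing Implicit Defensive.

Import Order.TTheory GRing.Theory Num.Theory.

Local Open Scope ring_scope.

(* Laurent polynomials are represented by their finitely supported coefficient
   functions, f@_k being the coefficient of X^k. The type {malg R[int]} comes
   with the additive structure only: monalg builds a product on {malg R[M]} for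
   monoids M without non-trivial units, which excludes (int, +). Products with
   rational functions are taken in {fraction {poly R}}, see laurent_frac. *)
Notation laurent R := {malg R[int]}.

Definition laurent_shift (R : zmodType) (n : int) (f : laurent R) : laurent R :=
  \sum_(k <- msupp f) << f@_k *g n + k >>.

Lemma laurent_shiftE (R : zmodType) n (f : laurent R) k :
  (laurent_shift n f)@_k = f@_(k - n).
Proof.
rewrite /laurent_shift raddf_sum /=.
under eq_bigr => i _ do rewrite mcoeffU addrC -[_ == k](inj_eq (addIr (- n))) addrK.
have [kf|kf] := boolP (k - n \in msupp f); last first.
  rewrite (mcoeff_outdom kf) big_seq big1 // => i fi.
  by case: eqVneq fi => [->|//]; rewrite (negPf kf).
rewrite (bigD1_seq (k - n)) ?fset_uniq //= eqxx big1 ?addr0 // => i.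
by move=> /negPf->.
Qed.

Definition nonneg_laurent (R : realType) (f : laurent R) : Prop :=
  forall k, 0 <= f@_k.

Definition nonneg_laurent_nz (R : realType) (f : laurent R) : Prop :=
  nonneg_laurent f /\ f != 0.

(* The neutral elements of the iterated extrema are the values at f = 0. *)
Definition deg_plus (R : zmodType) (f : laurent R) : \bar int :=
  \big[Order.max/-oo%E]_(k <- msupp f) k%:E%E.

Definition deg_minus (R : zmodType) (f : laurent R) : \bar int :=
  \big[Order.min/+oo%E]_(k <- msupp f) k%:E%E.

Definition wreathZZ : Type := (laurent int * int)%type.

HB.instance Definition _ := Choice.on wreathZZ.

Definition wr_one : wreathZZ := (0, 0).
Definition wr_mul (u v : wreathZZ) : wreathZZ :=
  (u.1 + laurent_shift u.2 v.1, u.2 + v.2).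
Definition wr_inv (u : wreathZZ) : wreathZZ :=
  (- laurent_shift (- u.2) u.1, - u.2).

Lemma wr_mulA : associative wr_mul.
Proof.
move=> [y b] [y' b'] [y'' b'']; congr pair => /=; last by rewrite addrA.
apply/malgP => k; rewrite !(laurent_shiftE, mcoeffD) addrA.
by rewrite opprD addrA.
Qed.

Lemma wr_mul1 : left_id wr_one wr_mul.
Proof.
move=> [y b]; congr pair; rewrite /= ?add0r //.
by apply/malgP => k; rewrite laurent_shiftE subr0.
Qed.

Lemma wr_mulr1 : right_id wr_one wr_mul.
Proof.
move=> [y b]; congr pair; rewrite /= ?addr0 //.
by apply/malgP => k; rewrite mcoeffD laurent_shiftE mcoeff0 addr0.
Qed.

Lemma wr_mulV : left_inverse wr_one wr_inv wr_mul.
Proof. by move=> [y b]; congr pair; rewrite /= addNr. Qed.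

Lemma wr_mulrV : right_inverse wr_one wr_inv wr_mul.
Proof.
move=> [y b]; congr pair; last exact: subrr.
apply/malgP => k; rewrite mcoeffD laurent_shiftE mcoeffN laurent_shiftE mcoeff0.
by rewrite opprK subrK subrr.
Qed.

HB.instance Definition _ :=
  isGroup.Build wreathZZ wr_mulA wr_mul1 wr_mulr1 wr_mulV wr_mulrV.

Section Semigroups.
Variable T : monoidType.
Local Open Scope group_scope.

Definition semigroup_gen (G : {pred T}) (x : T) : Prop :=
  exists s : seq T, [/\ s != [::], {subset s <= G} & x = \prod_(z <- s) z].

(* A subset closed under products, as all the semigroup_gen G are, is a group
   for the multiplication of T; its neutral element is not assumed to be 1. *)
Definition is_group (H : T -> Prop) : Prop :=
  exists2 e, H e & forall x, H x ->
    [/\ e * x = x, x * e = x & exists2 z, H z & x * z = e /\ z * x = e].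

End Semigroups.

(* The map on fraction fields induced by an injective ring morphism phi
   (frac_mapE shows that it does not depend on the representative). *)
Definition frac_map (R S : idomainType) (phi : R -> S) (x : {fraction R}) :
    {fraction S} :=
  tofrac (phi (frac (repr x)).1) / tofrac (phi (frac (repr x)).2).

Lemma tofrac_repr (R : idomainType) (x : {fraction R}) :
  tofrac (frac (repr x)).1 = x * tofrac (frac (repr x)).2.
Proof.
apply/eqP; rewrite -{2}[x]reprK; move: (repr x) => r.
rewrite piE /FracField.equivf /FracField.mulf !numden_Ratio;
  by rewrite ?mulr1 ?mul1r ?mulf_neq0 ?oner_eq0 ?denom_ratioP // mulrC.
Qed.

Lemma frac_mapE (R S : idomainType) (phi : {rmorphism R -> S}) (n d : R) :
  injective phi -> d != 0 ->
  frac_map phi (tofrac n / tofrac d) = tofrac (phi n) / tofrac (phi d).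
Proof.
move=> phi_inj d0; rewrite /frac_map; set x := tofrac n / _.
have r0 := denom_ratioP (repr x).
have phi0 e : e != 0 -> tofrac (phi e) != 0.
  by rewrite tofrac_eq0 -(rmorph0 phi) (inj_eq phi_inj).
apply/eqP; rewrite eqr_div ?phi0 // -!tofracM tofrac_eq -!rmorphM.
apply/eqP; congr (phi _); apply/eqP; rewrite -tofrac_eq !tofracM.
by rewrite tofrac_repr mulrAC divfK ?tofrac_eq0.
Qed.

Definition embZQ : {fraction {poly int}} -> {fraction {poly rat}} :=
  frac_map (map_poly (intr : int -> rat)).

Definition embQR (R : realType) : {fraction {poly rat}} -> {fraction {poly R}} :=
  frac_map (map_poly (ratr : rat -> R)).

(* g(X) |-> g(X^d), for d > 0 *)
Definition frac_subst (d : nat) : {fraction {poly rat}} -> {fraction {poly rat}} :=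
  frac_map (comp_poly 'X^d).

Definition fracX {R : idomainType} : {fraction {poly R}} := tofrac 'X.

Definition laurent_frac (R : idomainType) (f : laurent R) : {fraction {poly R}} :=
  \sum_(k <- msupp f) tofrac (f@_k)%:P * fracX ^ k.

Section Data.
Variables (A : finType) (y : A -> laurent int) (b : A -> int).

Definition wr_elt (a : A) : wreathZZ := (y a, b a).

Definition idx_pos : {set A} := [set a | 0 < b a].
Definition idx_neg : {set A} := [set a | b a < 0].
Definition idx_zero : {set A} := [set a | b a == 0].

Definition step : nat := \big[gcdn/0]_(a in idx_pos :|: idx_neg) `|b a|%N.

Definition hfrac (i j : A) : {fraction {poly rat}} :=
  embZQ (laurent_frac (y i))
    / (\sum_(0 <= t < `|b i| %/ step) fracX ^+ (t * step))
  + embZQ (laurent_frac (y j))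
    / (\sum_(1 <= t < (`|b j| %/ step).+1) fracX ^- (t * step)).

End Data.

Definition double_full (A : finType) (I J : {set A}) (S : {set A * A}) : Prop :=
  [/\ S \subset setX I J,
      forall i, i \in I -> exists2 j, j \in J & (i, j) \in S
    & forall j, j \in J -> exists2 i, i \in I & (i, j) \in S].

(* Main.v *)
From HB Require Import structures.
Require Import Defs.
From mathcomp Require Import all_boot all_order all_algebra fraction finmap.
From mathcomp Require Import reals constructive_ereal.
From mathcomp Require Import lra ring zify.

(* The semigroup is a group if and only if some word in which every letter
   occurs represents 1. Such a word is a closed walk in Z, with step b_a / d for
   the letter a, and counting the positions at which a is read gives a polynomial
   f_a; the second component of the word being 0 means that the f_a are balanced,
   the first one that sum_a f_a y_a = 0.

   From a closed walk: each step of length n > 0 crosses n unit intervals, and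
   every unit interval is crossed upwards as often as downwards. If F_i and F_j
   count the crossings due to the letters i and j, and F = sum_i F_i = sum_j F_j,
   then f_(i,j) = F_i F_j / F, coefficient by coefficient, distributes the
   crossings over the pairs. A letter k is read at a position adjacent to a crossed
   interval, hence the degree conditions.

   To a closed walk: the real solution is first replaced by a positive integral
   one with the same support, as the equations are linear with rational
   coefficients. With l a common multiple of the step lengths, the closed word
   i^(l/b_i) j^(l/|b_j|) read from c contributes
   X^c (1 + X + ... + X^(l-1)) h_(i,j), so after multiplication by
   (1 + ... + X^(l-1)) (1 + ... + X^N) the solution is a multiset of explicit
   loops. For large N it is connected, because the steps have gcd 1 and the
   degree conditions keep the letters k within reach, so that all the loops can be
   inserted into each other to form one closed walk. *)

Set Implicit Arguments.
Unset Strict Implicit.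
Unset Printing Implicit Defensive.

Import Order.TTheory GRing.Theory Num.Theory.

Local Open Scope ring_scope.

(** * Induced morphisms of fraction fields and evaluation of Laurent polynomials *)

Lemma fraction_ratio (R : idomainType) (x : {fraction R}) :
  exists n d : R, d != 0 /\ x = tofrac n / tofrac d.
Proof.
exists (frac (repr x)).1, (frac (repr x)).2; have d0 := denom_ratioP (repr x).
by rewrite tofrac_repr mulfK ?tofrac_eq0.
Qed.

(* frac_map with the injectivity proof as a parameter, for the sake of the
   ring morphism instance. *)
Definition frac_morph (R S : idomainType) (phi : {rmorphism R -> S})
  (phi_inj : injective phi) : {fraction R} -> {fraction S} := frac_map phi.

Section FracMorph.
Variables (R S : idomainType) (phi : {rmorphism R -> S}).
Hypothesis phi_inj : injective phi.

Let phi0 e : e != 0 -> tofrac (phi e) != 0.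
Proof. by rewrite tofrac_eq0 -(rmorph0 phi) (inj_eq phi_inj). Qed.

Lemma frac_map_tofrac p : frac_map phi (tofrac p) = tofrac (phi p).
Proof.
by rewrite -[tofrac p]divr1 -tofrac1 frac_mapE ?oner_eq0// rmorph1 tofrac1 divr1.
Qed.

Lemma frac_morph_is_zmod_morphism : zmod_morphism (frac_morph phi_inj).
Proof.
move=> x y; have [n [d [d0 ->]]] := fraction_ratio x.
have [n' [d' [d'0 ->]]] := fraction_ratio y.
rewrite -mulNr addf_div ?tofrac_eq0// -tofracN -!tofracM -tofracD /frac_morph.
rewrite !frac_mapE ?mulf_neq0// -[in RHS]mulNr addf_div ?phi0//.
by rewrite !(rmorphM, rmorphD, rmorphN).
Qed.

Lemma frac_morph_is_monoid_morphism : monoid_morphism (frac_morph phi_inj).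
Proof.
split=> [|x y]; first by rewrite /frac_morph -tofrac1 frac_map_tofrac !rmorph1.
have [n [d [d0 ->]]] := fraction_ratio x.
have [n' [d' [d'0 ->]]] := fraction_ratio y.
rewrite mulf_div -!tofracM /frac_morph.
by rewrite !frac_mapE ?mulf_neq0// mulf_div !rmorphM.
Qed.

HB.instance Definition _ := GRing.isZmodMorphism.Build _ _ (frac_morph phi_inj)
  frac_morph_is_zmod_morphism.
HB.instance Definition _ := GRing.isMonoidMorphism.Build _ _
  (frac_morph phi_inj) frac_morph_is_monoid_morphism.

End FracMorph.

Section FracMapComp.
Variables (R S T : idomainType).
Variables (phi : {rmorphism R -> S}) (psi : {rmorphism S -> T}).
Hypotheses (phi_inj : injective phi) (psi_inj : injective psi).

Lemma frac_map_comp x :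
  frac_map psi (frac_map phi x) = frac_map (psi \o phi) x.
Proof.
have [n [d [d0 ->]]] := fraction_ratio x.
rewrite !frac_mapE //; first exact: inj_comp.
by rewrite -(rmorph0 phi) (inj_eq phi_inj).
Qed.

End FracMapComp.

Lemma eq_frac_map (R S : idomainType) (phi psi : R -> S) :
  phi =1 psi -> frac_map phi =1 frac_map psi.
Proof. by move=> e x; rewrite /frac_map !e. Qed.

Lemma map_poly_intr_inj : injective (map_poly (intr : int -> rat)).
Proof. by apply: map_inj_poly => //; exact: intr_inj. Qed.

Lemma map_poly_ratr_inj (F : numFieldType) :
  injective (map_poly (ratr : rat -> F)).
Proof. exact: map_poly_inj. Qed.

Lemma comp_polyXn_inj (R : comNzRingType) d :
  (0 < d)%N -> injective (comp_poly ('X^d : {poly R})).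
Proof.
move=> d0 p q /polyP pq; apply/polyP => i; have := pq (i * d)%N.
by rewrite !coef_comp_poly_Xn // dvdn_mull // mulnK.
Qed.

Lemma fracX_neq0 (R : idomainType) : fracX != 0 :> {fraction {poly R}}.
Proof. by rewrite tofrac_eq0 polyX_eq0. Qed.

(** The product of all the denominators serves. Identities between finitely many fractions can then
    be read off the coefficients of numerators. *)
Lemma common_denominator (T : finType) (R : idomainType) (u : T -> {fraction R}) :
  exists2 d : R, d != 0 & exists p, forall t, u t = tofrac (p t) / tofrac d.
Proof.
have [q qE] : exists q : T -> R * R,
    forall t, (q t).2 != 0 /\ u t = tofrac (q t).1 / tofrac (q t).2.
  exists (fun t => ((frac (repr (u t))).1, (frac (repr (u t))).2)) => t /=.
  have d0 := denom_ratioP (repr (u t)); split=> //.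
  by rewrite tofrac_repr mulfK ?tofrac_eq0.
have q0 t : (q t).2 != 0 by have [] := qE t.
exists (\prod_t (q t).2); first by apply/prodf_neq0 => t _.
exists (fun t => (q t).1 * \prod_(s | s != t) (q s).2) => t.
rewrite (proj2 (qE t)) [X in _ = _ / tofrac X](bigD1 t)//= !tofracM.
rewrite -mulf_div divff ?mulr1//.
by rewrite tofrac_eq0; apply/prodf_neq0.
Qed.

(** Uniqueness of the decomposition along 1, X, ..., X^(d-1): once a common denominator in X^d is
    cleared, the m-th term only has exponents congruent to m modulo d, so different terms cannot
    cancel. *)
Lemma frac_decomp0 (R : idomainType) d (u : nat -> {fraction {poly R}}) :
  (0 < d)%N ->
  \sum_(m < d) frac_map (comp_poly 'X^d) (u m) * fracX ^+ m = 0 ->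
  forall m, (m < d)%N -> u m = 0.
Proof.
move=> d0 + m md; have [D D0 [p pE]] := common_denominator (fun m : 'I_d => u m).
have cD0 : tofrac (D \Po 'X^d) != 0.
  by rewrite tofrac_eq0 -(comp_poly0 'X^d) (inj_eq (comp_polyXn_inj d0)).
have -> : \sum_(k < d) frac_map (comp_poly 'X^d) (u k) * fracX ^+ k
    = (\sum_(k < d) tofrac ((p k \Po 'X^d) * 'X^k)) / tofrac (D \Po 'X^d).
  rewrite mulr_suml; apply: eq_bigr => k _.
  rewrite pE (frac_mapE _ (comp_polyXn_inj d0) D0) mulrAC.
  by rewrite [in RHS]tofracM [in RHS]tofracXn.
move=> /eqP; rewrite mulf_eq0 invr_eq0 (negPf cD0) orbF.
rewrite -(rmorph_sum (@tofrac {poly R})) /= tofrac_eq0 => /eqP /polyP e.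
rewrite -[m]/(nat_of_ord (Ordinal md)) pE; suff -> : p (Ordinal md) = 0.
  by rewrite tofrac0 mul0r.
(* The exponent i * d + m isolates the i-th coefficient of the m-th numerator. *)
apply/polyP => i; have := e (i * d + m)%N; rewrite coef_sum !coef0.
rewrite (bigD1 (Ordinal md))//= big1 => [|k km].
  rewrite coefMXn ltnNge leq_addl /= addnK coef_comp_poly_Xn// dvdn_mull//.
  by rewrite mulnK // addr0.
rewrite coefMXn; case: ltnP => // kl; rewrite coef_comp_poly_Xn//.
case: ifP => // /dvdnP[j jE]; case/negP: km; apply/eqP/val_inj => /=.
have : (i * d + m = j * d + k)%N by rewrite -jE subnK.
by move/(congr1 (modn^~ d)); rewrite !modnMDl !modn_small.
Qed.

Section LaurentEval.
Variables (R : idomainType) (F : fieldType) (iota : {rmorphism R -> F}) (X : F).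

(** [laurent_frac] is the case where [iota] embeds the constants and [X] is [fracX]. The other cases
    that occur evaluate at X^d. *)
Definition leval (f : laurent R) : F := mmap iota (exprz X) f.

HB.instance Definition _ := GRing.isZmodMorphism.Build (laurent R) F leval
  (@mmap_is_additive _ _ _ iota (exprz X)).

Lemma levalU k a : leval << a *g k >> = iota a * X ^ k.
Proof. exact: mmapU. Qed.

Lemma leval_shift n f : X != 0 -> leval (laurent_shift n f) = X ^ n * leval f.
Proof.
move=> X0; rewrite /laurent_shift raddf_sum [leval f in RHS]/leval mmapE mulr_sumr.
by apply: eq_bigr => k _; rewrite [LHS]levalU expfzDr // mulrCA.
Qed.

End LaurentEval.

Lemma frac_map_laurent (R S : idomainType) (phi : {rmorphism {poly R} -> {poly S}})
    (f : laurent R) :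
  injective phi ->
  frac_map phi (laurent_frac f)
  = leval (@tofrac _ \o phi \o polyC) (tofrac (phi 'X)) f.
Proof.
move=> phi_inj; rewrite -[frac_map phi _]/(frac_morph phi_inj _) rmorph_sum.
apply: eq_bigr => k _; rewrite rmorphM /= fmorphXz /frac_morph.
rewrite frac_map_tofrac//; congr (_ * _ ^ k); exact: frac_map_tofrac.
Qed.

Lemma fracXz_posz (R : idomainType) (n : nat) (k : int) :
  n%:Z + k >= 0 -> (fracX : {fraction {poly R}}) ^+ n * fracX ^ k
                   = tofrac 'X^(absz (n%:Z + k)%R).
Proof.
move=> nk; rewrite -[fracX ^+ n]/(fracX ^ n%:Z) -expfzDr ?fracX_neq0//.
by rewrite -{1}[n%:Z + k]gez0_abs// -exprnP tofracXn.
Qed.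

Lemma laurent_frac_eq0 (R : idomainType) (f : laurent R) :
  laurent_frac f = 0 -> f = 0.
Proof.
(* Multiplication by X^n makes all exponents non-negative, and a polynomial vanishes only if its
   coefficients do. *)
move=> f0; pose n := \max_(k <- msupp f) `|k|%N.
have nk k : k \in msupp f -> n%:Z + k >= 0.
  move=> kf; rewrite -[k]opprK subr_ge0.
  apply: le_trans (ler_norm _) _; rewrite normrN -abszE lez_nat.
  by rewrite /n; apply: leq_bigmax_seq.
have e : tofrac (\sum_(k <- msupp f) (f@_k)%:P * 'X^(absz (n%:Z + k)%R)) = 0.
  transitivity (fracX ^+ n * laurent_frac f); last by rewrite f0 mulr0.
  rewrite rmorph_sum /laurent_frac mulr_sumr [LHS]big_seq [RHS]big_seq.
  by apply: eq_bigr => k kf; rewrite rmorphM /= mulrCA fracXz_posz// nk.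
have {}e : \sum_(k <- msupp f) (f@_k)%:P * 'X^(absz (n%:Z + k)%R) = 0 :> {poly R}.
  by apply/eqP; rewrite -tofrac_eq0 e.
apply/malgP => k; rewrite mcoeff0.
have [kf|/mcoeff_outdom //] := boolP (k \in msupp f).
have := congr1 (coefp (absz (n%:Z + k))) e; rewrite raddf_sum /= coef0.
rewrite (bigD1_seq k) ?fset_uniq//= coefCM coefXn eqxx mulr1.
rewrite big_seq_cond big1 ?addr0 // => j /andP[jf jk].
rewrite coefCM coefXn; case: eqP => [|_]; last by rewrite mulr0.
move/(congr1 Posz); rewrite !gez0_abs ?nk// => /addrI kj.
by rewrite kj eqxx in jk.
Qed.

(** * Positive solutions of rational linear systems *)

(** The kernel is spanned by the rational rows of [kermx M], and positivity is an open condition: it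
    survives replacing the real coefficients [u] of [v] by close rational ones. *)
Lemma pos_rat_kernel (R : realType) n m (M : 'M[rat]_(n, m)) (v : 'rV[R]_n) :
  (forall i, 0 < v 0 i) -> v *m map_mx ratr M = 0 ->
  exists2 w : 'rV[rat]_n, forall i, 0 < w 0 i & w *m M = 0.
Proof.
move=> v0 /sub_kermxP; rewrite -map_kermx => /submxP[u uE].
pose mu := \big[Num.min/1]_i v 0 i.
have mu0 : 0 < mu by apply: lt_bigmin => // i _; exact: v0.
have mu_le i : mu <= v 0 i by exact: bigmin_le_cond.
(* Changing each coefficient by at most mu / C changes every entry by less than mu, the lower bound
   for the entries of [v]. The summand 1 gives strictness. *)
pose C : R := 1 + \sum_i \sum_j `|ratr (kermx M i j)|.
have C0 : 0 < C by rewrite ltr_pwDl ?sumr_ge0// => i _; rewrite sumr_ge0.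
have /fin_all_exists[q qE] i : exists q : rat,
    ratr q \in `]u 0 i - mu / C, u 0 i + mu / C[.
  by apply: rat_in_itvoo; rewrite ltrBlDr -addrA ltrDl addr_gt0 ?divr_gt0.
exists ((\row_i q i) *m kermx M); last by rewrite -mulmxA mulmx_ker mulmx0.
move=> j; rewrite -(ltr_rat R) rmorph0 !mxE.
have -> : ratr (\sum_i (\row_i q i) 0 i * kermx M i j)
  = v 0 j - \sum_i (u 0 i - ratr (q i)) * ratr (kermx M i j).
  rewrite uE !mxE -sumrB rmorph_sum; apply: eq_bigr => i _.
  by rewrite !mxE rmorphM mulrBl opprB addrC subrK.
rewrite subr_gt0; apply: lt_le_trans (mu_le j).
apply: (@le_lt_trans _ _ (\sum_i mu / C * `|ratr (kermx M i j)|)).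
  apply: ler_sum => i _; apply: le_trans (ler_norm _) _; rewrite normrM.
  rewrite ler_wpM2r//; have := qE i; rewrite in_itv /= ler_norml => /andP[].
  lra.
rewrite -mulr_sumr mulrAC ltr_pdivrMr// ltr_pM2l// ltr_pwDl//.
apply: ler_sum => i _; rewrite (bigD1 j)//= lerDl.
by rewrite sumr_ge0.
Qed.

Lemma nat_multiple (n : nat) (w : 'rV[rat]_n) : (forall i, 0 < w 0 i) ->
  exists2 c : rat, c != 0 & exists2 k : 'I_n -> nat,
    forall i, (0 < k i)%N & forall i, (k i)%:R = c * w 0 i.
Proof.
move=> w0; pose c : rat := \prod_i (denq (w 0 i))%:~R.
have c0 : 0 < c by apply: prodr_gt0 => i _; rewrite ltr0z denq_gt0.
have kE i : exists k : nat, k%:R = c * w 0 i.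
  have : exists z : int, z%:~R = c * w 0 i.
    exists ((\prod_(j | j != i) denq (w 0 j)) * numq (w 0 i)).
    rewrite /c [X in _ = X * _](bigD1 i)//= intrM (rmorph_prod intr) /= numqE.
    by ring.
  move=> [z zE]; exists `|z|%N.
  rewrite -zE -[X in _ = X%:~R]gez0_abs// -(ler0z rat) zE.
  by rewrite mulr_ge0 ?ltW// w0.
have [k kE'] := fin_all_exists kE.
exists c; first by rewrite gt_eqF.
by exists k => // i; rewrite -(ltr_nat rat) kE' mulr_gt0.
Qed.

Lemma embQRE (R : realType) :
  @embQR R = frac_morph (@map_poly_ratr_inj R).
Proof. by []. Qed.

Lemma embQR_fracXn (R : realType) n : embQR R (fracX ^+ n) = fracX ^+ n.
Proof.
rewrite embQRE rmorphXn; congr (_ ^+ _).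
apply: etrans (frac_map_tofrac (@map_poly_ratr_inj R) _) _.
by rewrite /= map_polyX.
Qed.

(** Over a common denominator, the relation amounts to one rational linear equation in the [r t] for
    each coefficient of the numerators, collected in [M]. A positive rational solution is then
    scaled to an integral one. *)
Lemma pos_nat_relation (R : realType) (T : finType) (r : T -> R)
    (u : T -> {fraction {poly rat}}) :
  (forall t, 0 < r t) ->
  \sum_t tofrac (r t)%:P * embQR R (u t) = 0 ->
  exists2 k : T -> nat, forall t, (0 < k t)%N
                      & \sum_t (k t)%:R * embQR R (u t) = 0.
Proof.
move=> r0 ru0; have [d d0 [p pE]] := common_denominator u.
pose D : {fraction {poly R}} := tofrac (map_poly ratr d).
have D0 : D != 0 by rewrite tofrac_eq0 map_poly_eq0.
have uE t : embQR R (u t) = tofrac (map_poly ratr (p t)) / D.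
  by rewrite pE; exact: (frac_mapE _ (@map_poly_ratr_inj R) d0).
pose m := \max_t size (p t).
pose M : 'M[rat]_(#|T|, m) := \matrix_(i, j) (p (enum_val i))`_j.
have : (\row_i r (enum_val i)) *m map_mx ratr M = 0.
  have : \sum_t (r t)%:P * map_poly ratr (p t) = 0.
    apply/eqP; rewrite -tofrac_eq0 -[_ == 0](mulrI_eq0 _ (mulfI (invr_neq0 D0))).
    apply/eqP; rewrite -[RHS]ru0 rmorph_sum mulr_sumr.
    by apply: eq_bigr => t _; rewrite rmorphM /= uE mulrC mulrA.
  move=> /polyP e; apply/rowP => j; have := e j; rewrite coef_sum !coef0.
  rewrite (reindex_onto _ _ (in1W (@enum_rankK T))) /= !mxE => {2}<-.
  apply: eq_big => [i|i _]; first by rewrite enum_valK eqxx.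
  by rewrite !mxE coefCM coef_map.
move=> /pos_rat_kernel[|w w0 wM]; first by move=> i; rewrite mxE.
have [c c0 [k k0 kE]] := nat_multiple w0.
exists (k \o enum_rank) => [t|]; first exact: k0.
suff e : \sum_t (k (enum_rank t))%:R *: p t = 0.
  transitivity (embQR R (tofrac (\sum_t (k (enum_rank t))%:R *: p t) / tofrac d)).
    rewrite rmorph_sum /= mulr_suml embQRE rmorph_sum; apply: eq_bigr => t _ /=.
    rewrite -mul_polyC [tofrac _]rmorphM /= -mulrA -pE rmorphM polyC_natr.
    by rewrite !rmorph_nat.
  by rewrite e tofrac0 mul0r embQRE rmorph0.
apply/polyP => j; rewrite coef0 coef_sum.
have [jm|mj] := ltnP j m; last first.
  rewrite big1// => t _; rewrite coefZ nth_default ?mulr0//.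
  by apply: leq_trans mj; exact: leq_bigmax.
have /rowP/(_ (Ordinal jm)) := wM; rewrite !mxE => e.
transitivity (c * 0); last exact: mulr0.
rewrite -[in RHS]e mulr_sumr.
rewrite (reindex_onto _ _ (in1W (@enum_rankK T))) /=.
apply: eq_big => [i|i _]; first by rewrite enum_valK eqxx.
by rewrite coefZ !mxE /= enum_valK kE mulrA.
Qed.

(** * Walks *)

Section Walk.
Variables (A : eqType) (b : A -> int).

Definition disp (w : seq A) : int := \sum_(a <- w) b a.

(* A step is recorded together with the position from which it is taken. *)
Fixpoint walk (z : int) (w : seq A) : seq (int * A) :=
  if w is a :: w' then (z, a) :: walk (z + b a) w' else [::].

Lemma disp_cat u v : disp (u ++ v) = disp u + disp v.
Proof. exact: big_cat. Qed.

Lemma disp_cons a w : disp (a :: w) = b a + disp w.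
Proof. exact: big_cons. Qed.

Lemma disp_nil : disp [::] = 0.
Proof. exact: big_nil. Qed.

Lemma disp_nseq n a : disp (nseq n a) = b a *+ n.
Proof. by elim: n => [|n IH]; rewrite ?disp_nil// disp_cons IH mulrS. Qed.

Lemma walk_cat z u v : walk z (u ++ v) = walk z u ++ walk (z + disp u) v.
Proof.
elim: u z => [|a u IH] z /=; first by rewrite disp_nil addr0.
by rewrite IH disp_cons addrA.
Qed.

Lemma map_snd_walk z w : map snd (walk z w) = w.
Proof. by elim: w z => //= a w IH z; rewrite IH. Qed.

Lemma walk_split z w p : p \in walk z w ->
  exists u v, w = u ++ p.2 :: v /\ p.1 = z + disp u.
Proof.
elim: w z => //= a w IH z; rewrite inE => /predU1P[->|/IH[u [v [-> ->]]]].
  by exists [::], w; rewrite disp_nil addr0.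
by exists (a :: u), v; rewrite disp_cons addrA.
Qed.

(** After [v] the closed walk is back at [z], so that [u] is read from the same positions as
    before. *)
Lemma walk_rot z u v : disp (u ++ v) = 0 ->
  perm_eq (walk (z + disp u) (v ++ u)) (walk z (u ++ v)).
Proof.
rewrite disp_cat => uv0; rewrite !walk_cat -addrA uv0 addr0.
by rewrite perm_catC.
Qed.

Lemma mem_walk_letter z w a : a \in w -> exists c, (c, a) \in walk z w.
Proof.
by rewrite -{1}(map_snd_walk z w) => /mapP[[c a'] pw /= ->]; exists c.
Qed.

(** A discrete intermediate value argument: the first step ending above [e] starts at or below
    [e]. *)
Lemma walk_crossing z w e : z <= e < z + disp w ->
  exists2 p, p \in walk z w & p.1 <= e < p.1 + b p.2.
Proof.
elim: w z => [|a w IH] z /=; first by rewrite disp_nil; lia.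
rewrite disp_cons => ze; have [za|za] := ltP e (z + b a).
  by exists (z, a); rewrite ?inE ?eqxx //=; lia.
have [|p pw pe] := IH (z + b a); first lia.
by exists p; rewrite // inE pw orbT.
Qed.

Lemma itv_indicator (R : comNzRingType) (x y e : int) : x <= y ->
  (x <= e < y)%R%:R = (x <= e)%R%:R - (y <= e)%R%:R :> R.
Proof.
move=> xy; case: (leP y e) => ye; first by rewrite (le_trans xy ye) /= subrr.
by rewrite andbT subr0.
Qed.

(** A telescoping sum: the signed crossing of the interval from e to e + 1 by a step is the decrease
    of the indicator of being at or below e. *)
Lemma walk_balance (R : comNzRingType) z w e :
  \sum_(p <- walk z w | 0 < b p.2) (p.1 <= e < p.1 + b p.2)%R%:R
  - \sum_(p <- walk z w | b p.2 < 0) (p.1 + b p.2 <= e < p.1)%R%:R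
  = (z <= e)%R%:R - (z + disp w <= e)%R%:R :> R.
Proof.
elim: w z => [|a w IH] z /=; first by rewrite disp_nil !big_nil addr0 !subrr.
have := IH (z + b a); rewrite disp_cons addrA !big_cons /=.
set U := \sum_(_ <- _ | _) _; set D := \sum_(_ <- _ | _) _ => e1.
have {e1} -> : U = D + ((z + b a <= e)%R%:R - (z + b a + disp w <= e)%R%:R).
  by rewrite -e1 addrC subrK.
case: ltgtP => ba; last first.
- by rewrite -ba addr0 addrAC subrr add0r.
- rewrite itv_indicator; last by rewrite gerDl ltW.
  ring.
- rewrite itv_indicator; last by rewrite lerDl ltW.
  ring.
Qed.
End Walk.

(** * From a closed walk to Laurent polynomials *)

Lemma sum_itv_eq (R : nzRingType) (n : nat) (x e : int) :
  \sum_(s < n) (x + s%:Z == e)%:R = (x <= e < x + n%:Z)%R%:R :> R.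
Proof.
have [xe|ex] := boolP (x <= e < x + n%:Z); last first.
  rewrite big1// => s _; case: eqP => //; have := ltn_ord s; lia.
have kn : (absz (e - x)%R < n)%N by lia.
rewrite (bigD1 (Ordinal kn))//= big1 => [|s sk]; last first.
  by case: eqP => // xs; case/negP: sk; apply/eqP/val_inj => /=; lia.
by rewrite addr0; case: eqP => //; lia.
Qed.

Section Coupling.
Variable R : realType.

(* Junk value: where the denominator vanishes, so does the quotient. *)
Definition laurent_coupling (f g h : laurent R) : laurent R :=
  \sum_(e <- msupp h) << f@_e * g@_e / h@_e *g e >>.

Lemma laurent_couplingE f g h e :
  (laurent_coupling f g h)@_e = f@_e * g@_e / h@_e.
Proof.
rewrite /laurent_coupling raddf_sum /=.
under eq_bigr => i _ do rewrite mcoeffU.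
have [eh|eh] := boolP (e \in msupp h); last first.
  rewrite (mcoeff_outdom eh) invr0 mulr0 big_seq big1// => i ih.
  by case: eqVneq ih => // -> /(negP eh).
rewrite (bigD1_seq e)//= eqxx big1 ?addr0 // => i.
by move=> /negPf->.
Qed.

End Coupling.

Section WalkToLaurent.
Variables (R : realType) (A : finType) (b : A -> int).
Variables (F : fieldType) (iota : {rmorphism R -> F}) (X : F) (Y : A -> F).
Hypothesis X0 : X != 0.
Hypothesis X1 : forall n, (0 < n)%N -> X ^+ n != 1.

Local Notation I := (idx_pos b).
Local Notation J := (idx_neg b).
Local Notation K := (idx_zero b).
Local Notation ev := (leval iota X).

(** With step lengths already divided by d and [X] standing for X^d, [up_den] and [down_den] are the
    two denominators in h_(i,j). *)
Definition up_den a := \sum_(s < `|b a|%N) X ^+ s.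
Definition down_den a := \sum_(s < `|b a|%N) X ^- s.+1.

Lemma up_den_neq0 a : b a != 0 -> up_den a != 0.
Proof.
move=> ba; have : X ^+ `|b a|%N != 1 by rewrite X1// absz_gt0.
by apply: contraNneq => e; rewrite -subr_eq0 subrX1 -/(up_den a) e mulr0.
Qed.

Lemma down_denE a : down_den a * X ^+ `|b a|%N = up_den a.
Proof.
rewrite /down_den /up_den mulr_suml (reindex_inj rev_ord_inj) /=.
apply: eq_bigr => s _; have sb := ltn_ord s; rewrite subnSK//.
rewrite -[X in _ * _ ^+ X](subnKC (ltnW sb)) exprD mulrCA mulVf ?mulr1//.
exact: expf_neq0.
Qed.

Lemma down_den_neq0 a : b a != 0 -> down_den a != 0.
Proof.
move=> ba; have := up_den_neq0 ba; rewrite -down_denE mulf_eq0 negb_or.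
by case/andP.
Qed.

Section Word.
Variable w : seq A.
Hypothesis w0 : disp b w = 0.
Hypothesis full : forall a, a \in w.

Local Notation W := (walk b 0 w).

Definition letter_laurent a : laurent R :=
  \sum_(p <- W | p.2 == a) << 1 *g p.1 >>.

(** A unit interval is indexed by its lower end. An upward step of length n from c therefore has the
    exponents c, ..., c + n - 1, and a downward one c - 1, ..., c - n. *)
Definition crossing_laurent a : laurent R :=
  if 0 < b a then \sum_(s < `|b a|%N) laurent_shift s%:Z (letter_laurent a)
  else \sum_(s < `|b a|%N) laurent_shift (- s.+1%:Z) (letter_laurent a).

Lemma letter_laurentE a e :
  (letter_laurent a)@_e = \sum_(p <- W | p.2 == a) (p.1 == e)%:R.
Proof.
by rewrite /letter_laurent raddf_sum; apply: eq_bigr => p _; rewrite /= mcoeffU.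
Qed.

Lemma letter_laurent_neq0 a e : (letter_laurent a)@_e != 0 -> (e, a) \in W.
Proof.
rewrite letter_laurentE; apply: contraNT => eW.
rewrite big_seq_cond big1// => -[c a'] /= /andP[cW /eqP aE].
by case: eqP => // ce; rewrite -ce -aE cW in eW.
Qed.

Lemma letter_laurent_nonneg a : nonneg_laurent (letter_laurent a).
Proof. by move=> e; rewrite letter_laurentE sumr_ge0. Qed.

Lemma letter_laurent_gt0 c a : (c, a) \in W -> 0 < (letter_laurent a)@_c.
Proof.
move=> cW; rewrite letter_laurentE (big_rem _ cW) /= !eqxx ltr_pwDl//.
exact: sumr_ge0.
Qed.

Lemma up_crossingE a e : 0 < b a ->
  (crossing_laurent a)@_e
  = \sum_(p <- W | p.2 == a) (p.1 <= e < p.1 + b p.2)%R%:R.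
Proof.
move=> ba; rewrite /crossing_laurent ba raddf_sum /=.
under eq_bigr => s _ do rewrite laurent_shiftE letter_laurentE.
rewrite exchange_big /=; apply: eq_bigr => p /eqP ->.
rewrite -[in RHS](gez0_abs (ltW ba)). rewrite -sum_itv_eq.
by apply: eq_bigr => s _; rewrite eq_sym subr_eq eq_sym.
Qed.

Lemma down_crossingE a e : b a < 0 ->
  (crossing_laurent a)@_e
  = \sum_(p <- W | p.2 == a) (p.1 + b p.2 <= e < p.1)%R%:R.
Proof.
move=> ba; rewrite /crossing_laurent ltNge ltW//= raddf_sum /=.
under eq_bigr => s _ do rewrite laurent_shiftE letter_laurentE.
rewrite exchange_big /=; apply: eq_bigr => p /eqP ->.
have -> : (p.1 + b a <= e < p.1) = (p.1 + b a <= e < p.1 + b a + `|b a|%N%:Z).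
  by lia.
rewrite -sum_itv_eq (reindex_inj rev_ord_inj) /=.
apply: eq_bigr => s _; have := ltn_ord s => sb; congr (_%:R); congr nat_of_bool.
by apply/eqP/eqP; lia.
Qed.

Lemma crossing_nonneg a e : b a != 0 -> 0 <= (crossing_laurent a)@_e.
Proof.
rewrite neq_lt => /orP[] ba.
  by rewrite down_crossingE// sumr_ge0.
by rewrite up_crossingE// sumr_ge0.
Qed.

Definition total_laurent : laurent R := \sum_(i in I) crossing_laurent i.

Lemma sum_by_letter (P : {set A}) (G : int * A -> R) :
  \sum_(a in P) \sum_(p <- W | p.2 == a) G p = \sum_(p <- W | p.2 \in P) G p.
Proof.
rewrite (exchange_big_dep (fun p => p.2 \in P)) /=; last by move=> a p aP /eqP->.
apply: eq_bigr => p pP; rewrite (big_pred1 p.2) // => a /=; rewrite eq_sym.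
by case: eqP => [->|_]; rewrite ?pP ?andbF.
Qed.

(** This is [walk_balance] for a closed walk, where the right-hand side vanishes. *)
Lemma total_laurent_down : total_laurent = \sum_(j in J) crossing_laurent j.
Proof.
apply/malgP => e; rewrite /total_laurent !raddf_sum /=; apply/eqP.
rewrite -subr_eq0.
have -> : \sum_(i in I) (crossing_laurent i)@_e
    = \sum_(p <- W | 0 < b p.2) (p.1 <= e < p.1 + b p.2)%R%:R.
  transitivity (\sum_(p <- W | p.2 \in I) (p.1 <= e < p.1 + b p.2)%R%:R : R);
    last first.
    by apply: eq_bigl => p; rewrite inE.
  rewrite -sum_by_letter; apply: eq_bigr => i; rewrite inE; exact: up_crossingE.
have -> : \sum_(j in J) (crossing_laurent j)@_e
    = \sum_(p <- W | b p.2 < 0) (p.1 + b p.2 <= e < p.1)%R%:R.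
  transitivity (\sum_(p <- W | p.2 \in J) (p.1 + b p.2 <= e < p.1)%R%:R : R);
    last first.
    by apply: eq_bigl => p; rewrite inE.
  rewrite -sum_by_letter; apply: eq_bigr => j; rewrite inE.
  exact: down_crossingE.
by rewrite walk_balance w0 addr0 subrr.
Qed.

Lemma crossing_le_total a e : b a != 0 ->
  (crossing_laurent a)@_e <= total_laurent@_e.
Proof.
move=> ba; have [ab|ba'|ab] := ltgtP (b a) 0; last by rewrite ab eqxx in ba.
- rewrite total_laurent_down raddf_sum (bigD1 a) ?inE//= lerDl sumr_ge0// => j.
  by rewrite inE => /andP[bj _]; rewrite crossing_nonneg // lt_eqF.
- rewrite /total_laurent raddf_sum (bigD1 a) ?inE//= lerDl sumr_ge0// => i.
  by rewrite inE => /andP[bi _]; rewrite crossing_nonneg // gt_eqF.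
Qed.

(** The product coupling on each unit interval. Its marginals are computed in [sum_pair_down] and
    [sum_pair_up]. *)
Definition pair_laurent (p : A * A) : laurent R :=
  laurent_coupling (crossing_laurent p.1) (crossing_laurent p.2) total_laurent.

Lemma pair_laurent_nonneg p : p \in setX I J -> nonneg_laurent (pair_laurent p).
Proof.
case: p => i j; rewrite !inE => /andP[/= bi bj] e; rewrite laurent_couplingE /=.
have ci := crossing_nonneg e (lt0r_neq0 bi).
have cj := crossing_nonneg e (ltr0_neq0 bj).
rewrite divr_ge0 ?mulr_ge0//; apply: le_trans ci _.
by rewrite crossing_le_total ?gt_eqF.
Qed.

Lemma total_laurent_eq0 a e : b a != 0 -> total_laurent@_e = 0 ->
  (crossing_laurent a)@_e = 0.
Proof.
move=> ba t0; apply/eqP; rewrite eq_le crossing_nonneg// andbT -t0.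
exact: crossing_le_total.
Qed.

(** The sum over J of the second factors cancels the denominator. Where the total is 0, the
    crossings by [i], which it dominates, are 0 as well. *)
Lemma sum_pair_down i : i \in I ->
  \sum_(j in J) pair_laurent (i, j) = crossing_laurent i.
Proof.
rewrite inE => bi; apply/malgP => e; rewrite raddf_sum /=.
under eq_bigr => j _ do rewrite laurent_couplingE /= mulrAC.
rewrite -mulr_sumr -[X in _ * X](raddf_sum (mcoeff e)) -total_laurent_down.
have [t0|t0] := eqVneq (total_laurent@_e) 0; last by rewrite divfK.
by rewrite t0 invr0 mulr0 mul0r total_laurent_eq0 ?gt_eqF.
Qed.

Lemma sum_pair_up j : j \in J ->
  \sum_(i in I) pair_laurent (i, j) = crossing_laurent j.
Proof.
rewrite inE => bj; apply/malgP => e; rewrite raddf_sum /=.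
under eq_bigr => i _ do rewrite laurent_couplingE /= -mulrA.
rewrite -mulr_suml -[X in X * _](raddf_sum (mcoeff e)) -/total_laurent mulrC.
have [t0|t0] := eqVneq (total_laurent@_e) 0; last by rewrite divfK.
by rewrite t0 invr0 mulr0 mul0r total_laurent_eq0 ?lt_eqF.
Qed.

Lemma leval_crossing_up i : i \in I ->
  ev (crossing_laurent i) = up_den i * ev (letter_laurent i).
Proof.
rewrite inE => bi; rewrite /crossing_laurent bi raddf_sum /= mulr_suml.
by apply: eq_bigr => s _; rewrite leval_shift.
Qed.

Lemma leval_crossing_down j : j \in J ->
  ev (crossing_laurent j) = down_den j * ev (letter_laurent j).
Proof.
rewrite inE => bj; rewrite /crossing_laurent ltNge ltW//= raddf_sum /= mulr_suml.
by apply: eq_bigr => s _; rewrite leval_shift.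
Qed.

Lemma leval_letter a :
  ev (letter_laurent a) = \sum_(p <- W | p.2 == a) X ^ p.1.
Proof.
rewrite /letter_laurent raddf_sum /=; apply: eq_bigr => p _.
by rewrite levalU rmorph1 mul1r.
Qed.

Definition pair_frac i j := Y i / up_den i + Y j / down_den j.

(** Summing the pairs over one index recovers the crossings of the other letter. These are its
    denominator times its letter polynomial, so the denominators in [pair_frac] cancel. *)
Lemma leval_pair_sum :
  \sum_(p in setX I J) ev (pair_laurent p) * pair_frac p.1 p.2
  + \sum_(k in K) ev (letter_laurent k) * Y k
  = \sum_(p <- W) X ^ p.1 * Y p.2.
Proof.
have -> : \sum_(p in setX I J) ev (pair_laurent p) * pair_frac p.1 p.2
    = \sum_(i in I) \sum_(j in J) ev (pair_laurent (i, j)) * pair_frac i j.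
  rewrite pair_big_dep /=; apply: eq_big => [[i j]|[i j] _] //=.
  by rewrite !inE.
rewrite /pair_frac.
under eq_bigr => i _ do under eq_bigr => j _ do rewrite mulrDr.
under eq_bigr => i _ do rewrite big_split /= -mulr_suml -raddf_sum.
rewrite big_split /= [X in _ + X + _]exchange_big /=.
under [X in _ + X + _]eq_bigr => j _ do rewrite -mulr_suml -raddf_sum.
have -> : \sum_(i in I) ev (\sum_(j in J) pair_laurent (i, j)) * (Y i / up_den i)
    = \sum_(i in I) ev (letter_laurent i) * Y i.
  apply: eq_bigr => i iI; rewrite sum_pair_down// leval_crossing_up//.
  rewrite [up_den i * _]mulrC mulrACA divff ?mulr1//.
  by move: iI; rewrite inE => bi; rewrite up_den_neq0 ?gt_eqF.
have -> : \sum_(j in J) ev (\sum_(i in I) pair_laurent (i, j)) * (Y j / down_den j)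
    = \sum_(j in J) ev (letter_laurent j) * Y j.
  apply: eq_bigr => j jJ; rewrite sum_pair_up// leval_crossing_down//.
  rewrite [down_den j * _]mulrC mulrACA divff ?mulr1//.
  by move: jJ; rewrite inE => bj; rewrite down_den_neq0 ?lt_eqF.
transitivity (\sum_a ev (letter_laurent a) * Y a).
  rewrite [RHS](bigID (mem I)) [X in _ = _ + X](bigID (mem J)) /= -addrA.
  congr (_ + (_ + _)); apply: eq_bigl => a; rewrite !inE; lia.
under [LHS]eq_bigr => a _ do rewrite leval_letter mulr_suml.
rewrite (exchange_big_dep predT)//=; apply: eq_bigr => p _.
by rewrite (big_pred1 p.2) => [|a]; rewrite 1?eq_sym.
Qed.

Lemma crossing_gt0_up p e : p \in W -> 0 < b p.2 ->
  p.1 <= e < p.1 + b p.2 -> 0 < (crossing_laurent p.2)@_e.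
Proof.
move=> pW bp pe; rewrite up_crossingE// (big_rem _ pW) /= eqxx pe.
by rewrite ltr_pwDl// sumr_ge0.
Qed.

Lemma crossing_gt0_down p e : p \in W -> b p.2 < 0 ->
  p.1 + b p.2 <= e < p.1 -> 0 < (crossing_laurent p.2)@_e.
Proof.
move=> pW bp pe; rewrite down_crossingE// (big_rem _ pW) /= eqxx pe.
by rewrite ltr_pwDl// sumr_ge0.
Qed.

Lemma crossing_laurent_neq0 a : b a != 0 -> crossing_laurent a != 0.
Proof.
move=> ba; have [c cW] := mem_walk_letter b 0 (full a).
have [e e0] : exists e, 0 < (crossing_laurent a)@_e.
  move: ba; rewrite neq_lt => /orP[] ba.
    by exists (c - 1); apply: (crossing_gt0_down cW) => //=; lia.
  by exists c; apply: (crossing_gt0_up cW) => //=; lia.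
by apply: contraTneq e0 => ->; rewrite mcoeff0 ltxx.
Qed.

Lemma total_laurent_supp p e : p \in W -> p.1 <= e < p.1 + b p.2 ->
  e \in msupp total_laurent.
Proof.
move=> pW pe; have bp : 0 < b p.2 by lia.
rewrite -mcoeff_neq0 gt_eqF//; apply: lt_le_trans (crossing_gt0_up pW bp pe) _.
by rewrite crossing_le_total ?gt_eqF.
Qed.

(** Rotate the walk to start at [c], and let its letter [i] be read at [c']. If this step does not
    itself provide the interval, the walk climbs from the end of the step back to [c], crossing c -
    1, or respectively from [c] up to [c'], crossing c. *)
Lemma total_laurent_range c k i : (c, k) \in W -> i \in I ->
  (exists2 e, e \in msupp total_laurent & c <= e + 1)
  /\ (exists2 e, e \in msupp total_laurent & e <= c).
Proof.
move=> cW; rewrite inE => bi; have [u [v [/= wE cE]]] := walk_split cW.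
pose w' := (k :: v) ++ u.
have ww' : {subset walk b c w' <= W}.
  move=> p; have /perm_mem -> // : perm_eq (walk b c w') W.
  by rewrite cE wE; apply: walk_rot; rewrite -wE.
have dw' : disp b w' = 0 by rewrite disp_cat addrC -disp_cat -wE.
have : i \in w' by rewrite mem_cat orbC -mem_cat -wE.
case/(mem_walk_letter b c) => c' c'w; have [u1 [u2 [/= w'E c'E]]] := walk_split c'w.
have sub1 p : p \in walk b c u1 -> p \in W.
  by move=> pu; apply: ww'; rewrite w'E walk_cat mem_cat pu.
have sub2 p : p \in walk b (c' + b i) u2 -> p \in W.
  move=> pu; apply: ww'; rewrite w'E walk_cat mem_cat -c'E /=.
  by rewrite inE pu !orbT.
have d2 : disp b u2 = - (disp b u1 + b i).
  by move: dw'; rewrite w'E disp_cat disp_cons; lia.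
have c'W : (c', i) \in W by apply: ww'.
split.
- have [cc|cc] := leP c (c' + b i).
    exists (c' + b i - 1); last lia.
    by apply: (total_laurent_supp c'W) => /=; lia.
  have [|p pu pe] := @walk_crossing _ b (c' + b i) u2 (c - 1); first by lia.
  exists (c - 1); last lia.
  by apply: total_laurent_supp pe; exact: sub2.
- have [cc|cc] := leP c' c.
    exists c' => //.
    by apply: (total_laurent_supp c'W) => /=; lia.
  have [|p pu pe] := @walk_crossing _ b c u1 c; first by lia.
  exists c => //.
  by apply: total_laurent_supp pe; exact: sub1.
Qed.

Lemma closed_walk_laurents : I != set0 ->
  \sum_(p <- W) X ^ p.1 * Y p.2 = 0 ->
  exists (S : {set A * A}) (fIJ : A * A -> laurent R) (f : A -> laurent R),
    [/\ double_full I J S,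
        forall p, p \in S -> nonneg_laurent_nz (fIJ p),
        forall k, k \in K -> nonneg_laurent_nz (f k),
        \sum_(p in S) ev (fIJ p) * pair_frac p.1 p.2
        + \sum_(k in K) ev (f k) * Y k = 0
      & forall c, c \in msupp (\sum_(k in K) f k) ->
          (exists2 e, e \in msupp (\sum_(p in S) fIJ p) & c <= e + 1)
          /\ (exists2 e, e \in msupp (\sum_(p in S) fIJ p) & e <= c)].
Proof.
case/set0Pn => i0 i0I W0.
(* The polynomials must be non-zero, so the pairs with a zero one are dropped. This changes no
   sum. *)
pose S := [set p in setX I J | pair_laurent p != 0].
have SE (V : nmodType) (G : A * A -> V) :
    (forall p, pair_laurent p = 0 -> G p = 0) ->
    \sum_(p in S) G p = \sum_(p in setX I J) G p.
  move=> G0; rewrite [RHS](bigID (fun p => pair_laurent p != 0)) /=.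
  rewrite [X in _ + X]big1 ?addr0 => [|p /andP[_ /negPn/eqP/G0]//].
  by apply: eq_bigl => p; rewrite inE.
exists S, pair_laurent, letter_laurent; split.
- split.
  + by apply/subsetP => p; rewrite inE => /andP[].
  (* If all pairs with [i] were dropped, the marginal at [i] would vanish, although [i] occurs in
     the word. *)
  + move=> i iI; apply/exists_inP; apply: contraT; rewrite negb_exists_in.
    move=> /forall_inP ij0; have: crossing_laurent i != 0.
      by apply: crossing_laurent_neq0; move: iI; rewrite inE; lia.
    rewrite -sum_pair_down// big1 ?eqxx// => j jJ; have := ij0 _ jJ.
    by rewrite inE in_setX iI jJ /= negbK => /eqP.
  + move=> j jJ; apply/exists_inP; apply: contraT; rewrite negb_exists_in.
    move=> /forall_inP ij0; have: crossing_laurent j != 0.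
      by apply: crossing_laurent_neq0; move: jJ; rewrite inE; lia.
    rewrite -sum_pair_up// big1 ?eqxx// => i iI; have := ij0 _ iI.
    by rewrite inE in_setX iI jJ /= negbK => /eqP.
- by move=> p; rewrite inE => /andP[pIJ p0]; split=> //; exact: pair_laurent_nonneg.
- move=> k _; split; first exact: letter_laurent_nonneg.
  have [c cW] := mem_walk_letter b 0 (full k).
  by apply: contraTneq (letter_laurent_gt0 cW) => ->; rewrite mcoeff0 ltxx.
- rewrite SE ?leval_pair_sum// => p ->.
  by rewrite raddf0 mul0r.
- have -> : \sum_(p in S) pair_laurent p = total_laurent.
    rewrite SE//; transitivity (\sum_(i in I) \sum_(j in J) pair_laurent (i, j)).
      rewrite pair_big_dep /=; apply: eq_big => [[i j]|[i j] _] //=.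
      by rewrite !inE.
    by apply: eq_bigr => i iI; rewrite sum_pair_down.
  move=> c; rewrite -mcoeff_neq0 raddf_sum /= => c0.
  have [k kK] : exists2 k, k \in K & (letter_laurent k)@_c != 0.
    apply/exists_inP; apply: contraNT c0; rewrite negb_exists_in.
    by move=> /forall_inP c0; rewrite big1// => k /c0 /negPn/eqP.
  by move/letter_laurent_neq0 => cW; exact: total_laurent_range cW i0I.
Qed.

End Word.
End WalkToLaurent.

(** * Merging loops *)

Section IntervalShift.
Variables (V : int -> bool) (u v : int).

Definition itv_shift_invariant (n : nat) : Prop :=
  forall c, u <= c -> c + n%:Z <= v -> V c = V (c + n%:Z).

(** A weak form of the theorem of Fine and Wilf, by Euclid's algorithm: a shift by n - m is one by n
    followed by one by -m, or in the opposite order near the right end. Length m + n leaves room for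
    one of the two. *)
Lemma itv_shift_gcd m n : (m + n)%N%:Z <= v - u ->
  itv_shift_invariant m -> itv_shift_invariant n ->
  itv_shift_invariant (gcdn m n).
Proof.
have [k] := ubnP (m + n)%N; elim: k m n => // k IH m n mnk len Vm Vn.
wlog mn : m n mnk len Vm Vn / (m <= n)%N.
  move=> wl; have [|nm] := leqP m n; first exact: wl.
  by rewrite gcdnC; apply: wl => //; [rewrite addnC|rewrite addnC|rewrite ltnW].
have [->|m0] := posnP m; first by rewrite gcd0n.
rewrite -(subnKC mn) gcdnDl; apply: IH => //; [lia|lia|].
move=> c uc cv; have [cn|cn] := leP (c + n%:Z) v.
  rewrite Vn// (Vm (c + (n - m)%N%:Z)); [|lia|lia].
  by congr V; lia.
have -> : V c = V (c - m%:Z).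
  by rewrite (Vm (c - m%:Z)); [congr V; lia|lia|lia].
by rewrite Vn; [congr V; lia|lia|lia].
Qed.

(** All partial gcds stay at most [M], so length 2M suffices for each use of [itv_shift_gcd]. *)
Lemma itv_shift_biggcd (T : finType) (P : pred T) (f : T -> nat) M :
  (2 * M)%N%:Z <= v - u ->
  (forall t, P t -> (f t <= M)%N /\ itv_shift_invariant (f t)) ->
  itv_shift_invariant (\big[gcdn/0%N]_(t | P t) f t).
Proof.
move=> len fM; suff [] : (\big[gcdn/0%N]_(t | P t) f t <= M)%N
  /\ itv_shift_invariant (\big[gcdn/0%N]_(t | P t) f t) by [].
apply: (big_ind (fun g => (g <= M)%N /\ itv_shift_invariant g)) => //.
  by split=> // c _ _; rewrite addr0.
move=> x y [xM Vx] [yM Vy]; split; last by apply: itv_shift_gcd => //; lia.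
have [->|x0] := posnP x; first by rewrite gcd0n.
by apply: leq_trans xM; rewrite dvdn_leq ?dvdn_gcdl.
Qed.

End IntervalShift.

Section Merge.
Variables (A : eqType) (b : A -> int).

Definition loop_walk (l : int * seq A) := walk b l.1 l.2.
Definition loop_vertices (l : int * seq A) : seq int := map fst (loop_walk l).

Lemma loop_vertices_split (l : int * seq A) c : c \in loop_vertices l ->
  exists u v, l.2 = u ++ v /\ c = l.1 + disp b u.
Proof.
case/mapP => p /walk_split[u [v [-> ->]]] ->.
by exists u, (p.2 :: v).
Qed.

Lemma mem_loop_vertices z u a v : z + disp b u \in loop_vertices (z, u ++ a :: v).
Proof.
by rewrite /loop_vertices /loop_walk walk_cat map_cat mem_cat /= inE eqxx orbT.
Qed.

(* Loops sharing a vertex are merged by inserting a rotation of one into the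
   other; connectedness makes it possible to merge all of them. *)
Lemma merge_loops (Ls : seq (int * seq A)) z0 :
  (forall l, l \in Ls -> disp b l.2 = 0) ->
  (forall V : pred int, V z0 ->
     (forall l, l \in Ls ->
        {in loop_vertices l &, forall c c', V c -> V c'}) ->
     forall l, l \in Ls -> has V (loop_vertices l)) ->
  exists w, disp b w = 0 /\
    perm_eq (walk b z0 w) (flatten (map loop_walk Ls)).
Proof.
move=> closed conn.
suff H n : (n <= size Ls)%N -> exists w Ls1 Ls2, [/\ perm_eq Ls (Ls1 ++ Ls2),
    size Ls1 = n, disp b w = 0
    & perm_eq (walk b z0 w) (flatten (map loop_walk Ls1))].
  have [//|w [Ls1 [Ls2 [P s1 w0 Pw]]]] := H (size Ls).
  have Ls20 : Ls2 = [::].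
    apply/size0nil; have := perm_size P; rewrite size_cat s1 -{1}[size Ls]addn0.
    by move/addnI.
  exists w; split=> //; apply: perm_trans Pw _.
  by rewrite perm_sym; apply/perm_flatten/perm_map; rewrite Ls20 cats0 in P.
elim: n => [_|n IH nLs].
  by exists [::], [::], Ls; split => //=; rewrite disp_nil.
have [|w [Ls1 [Ls2 [P s1 w0 Pw]]]] := IH; first exact: ltnW.
(* The positions reached so far. The base point is added because the walk may still be empty. *)
pose V c := (c == z0) || (c \in map fst (walk b z0 w)).
have [/hasP[l lL2 /hasP[c cl Vc]]|/hasPn noV] :=
    boolP (has (fun l => has V (loop_vertices l)) Ls2); last first.
  have [l lL2] : exists l, l \in Ls2.
    case: (Ls2) P => [|l L] P; last by exists l; rewrite inE eqxx.
    by move: nLs; rewrite (perm_size P) cats0 s1 ltnn.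
  have lL : l \in Ls by rewrite (perm_mem P) mem_cat lL2 orbT.
  (* If no remaining loop met [V], then [V] would be closed along all loops, since the merged ones
     lie inside it, and connectedness would make it meet [l]. *)
  case/negP: (noV _ lL2); apply: conn => // [|k]; first by rewrite /V eqxx.
  rewrite (perm_mem P) mem_cat => /orP[kL1|kL2] c c' ck c'k Vc.
    apply/orP; right; case/mapP: c'k => p pk ->; apply: map_f.
    rewrite (perm_mem Pw); apply/flattenP; exists (loop_walk k) => //.
    exact: map_f.
  by case/negP: (noV _ kL2); apply/hasP; exists c.
have [u [v [wE cE]]] : exists u v, w = u ++ v /\ c = z0 + disp b u.
  case/orP: Vc => [/eqP->|cw]; last exact: (@loop_vertices_split (z0, w)).
  by exists [::], w; rewrite disp_nil addr0.
have [u' [v' [lE cE']]] := loop_vertices_split cl.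
have l0 : disp b l.2 = 0 by rewrite closed// (perm_mem P) mem_cat lL2 orbT.
(* At the common vertex [c], the loop [l] is inserted, rotated so as to start there. *)
exists (u ++ (v' ++ u') ++ v), (l :: Ls1), (rem l Ls2); split.
- apply: perm_trans P _; rewrite perm_sym -cat1s -catA perm_catCA perm_cat2l.
  by rewrite perm_sym perm_to_rem.
- by rewrite /= s1.
- by move: w0 l0; rewrite wE lE !disp_cat; lia.
- have uv0 : disp b (v' ++ u') = 0 by rewrite disp_cat addrC -disp_cat -lE.
  rewrite /= walk_cat walk_cat uv0 addr0 perm_catCA; apply: perm_cat.
    by rewrite -cE cE' /loop_walk lE; apply: walk_rot; rewrite -lE.
  by rewrite -walk_cat -wE.
Qed.

End Merge.

(** * From Laurent polynomials to a closed walk *)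

Lemma mulrn_absz_gt0 (x : int) n : 0 < x -> x *+ n = (`|x| * n)%N%:Z.
Proof. by move=> x0; rewrite PoszM gtz0_abs// -mulr_natr natz. Qed.

Lemma mulrn_absz_lt0 (x : int) n : x < 0 -> x *+ n = - (`|x| * n)%N%:Z.
Proof. by move=> x0; rewrite PoszM ltz0_abs// mulNr opprK -mulr_natr natz. Qed.

Section LoopsToWalk.
Variables (A : finType) (b : A -> int).
Variables (F : fieldType) (X : F) (Y : A -> F).
Hypothesis X0 : X != 0.
Hypothesis X1 : forall n, (0 < n)%N -> X ^+ n != 1.

Local Notation I := (idx_pos b).
Local Notation J := (idx_neg b).
Local Notation K := (idx_zero b).

Definition walk_value z w : F := \sum_(p <- walk b z w) X ^ p.1 * Y p.2.

Lemma walk_value_cons z a w :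
  walk_value z (a :: w) = X ^ z * Y a + walk_value (z + b a) w.
Proof. by rewrite /walk_value /= big_cons. Qed.

Lemma walk_value_nil z : walk_value z [::] = 0.
Proof. by rewrite /walk_value /= big_nil. Qed.

Lemma walk_value_cat z u v :
  walk_value z (u ++ v) = walk_value z u + walk_value (z + disp b u) v.
Proof. by rewrite /walk_value walk_cat big_cat. Qed.

Lemma walk_value_shift z w : walk_value z w = X ^ z * walk_value 0 w.
Proof.
elim: w z => [|a w IH] z; first by rewrite !walk_value_nil mulr0.
rewrite !walk_value_cons IH [walk_value (0 + _) _]IH expr0z mul1r mulrDr.
by rewrite add0r mulrA -expfzDr.
Qed.

Lemma walk_value_nseq z n a :
  walk_value z (nseq n a) = X ^ z * (\sum_(t < n) X ^ (b a *+ t)) * Y a.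
Proof.
elim: n z => [|n IH] z; first by rewrite walk_value_nil big_ord0 mulr0 mul0r.
rewrite walk_value_cons IH big_ord_recl mulr0n expr0z mulrDr mulr1 mulrDl.
congr (_ + _); congr (_ * _); rewrite expfzDr// -mulrA; congr (_ * _).
rewrite mulr_sumr; apply: eq_bigr => t _.
by rewrite -expfzDr// mulrS.
Qed.

Variable l : nat.
Hypothesis l0 : (0 < l)%N.
Hypothesis bl : forall a, b a != 0 -> (`|b a| %| l)%N.

Definition level : F := \sum_(s < l) X ^+ s.

Let X1' : X - 1 != 0.
Proof. by rewrite subr_eq0; have := X1 (isT : 0 < 1)%N; rewrite expr1. Qed.

Definition pair_word i j := nseq (l %/ `|b i|) i ++ nseq (l %/ `|b j|) j.

(** Multiplied by X - 1, both sides become X^l - 1, on the left as a geometric sum in powers of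
    X^(b_i). *)
Lemma level_up_den i : i \in I ->
  (\sum_(t < l %/ `|b i|) X ^ (b i *+ t)) * up_den b X i = level.
Proof.
rewrite inE => bi; apply: (mulfI X1'); rewrite mulrCA.
rewrite /up_den -subrX1 /level -subrX1 mulrC.
have bl' : l = (`|b i| * (l %/ `|b i|))%N.
  by rewrite mulnC divnK// bl// gt_eqF.
rewrite [in RHS]bl' exprM [RHS]subrX1; congr (_ * _); apply: eq_bigr => t _.
by rewrite -exprM mulrn_absz_gt0.
Qed.

Lemma pair_word_disp_left i : i \in I -> disp b (nseq (l %/ `|b i|) i) = l%:Z.
Proof.
rewrite inE => bi; rewrite disp_nseq mulrn_absz_gt0//.
by rewrite mulnC divnK// bl// gt_eqF.
Qed.

Lemma pair_word_disp_right j : j \in J ->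
  disp b (nseq (l %/ `|b j|) j) = - l%:Z.
Proof.
rewrite inE => bj; rewrite disp_nseq mulrn_absz_lt0//.
by rewrite mulnC divnK// bl// lt_eqF.
Qed.

Lemma pair_word_disp i j : i \in I -> j \in J -> disp b (pair_word i j) = 0.
Proof.
move=> iI jJ; rewrite disp_cat pair_word_disp_left//.
by rewrite pair_word_disp_right// subrr.
Qed.

(** The descent from l starts its steps at the positive multiples of |b_j| up to l. Taking out the
    factor X^|b_j|, which turns [down_den] into [up_den], leaves the geometric sum of the upward
    case. *)
Lemma level_down_den j : j \in J ->
  (X ^+ l * \sum_(t < l %/ `|b j|) X ^ (b j *+ t)) * down_den b X j = level.
Proof.
move=> jJ; have bj : b j < 0 by rewrite inE in jJ.
have lE : l = (`|b j| * (l %/ `|b j|))%N.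
  by rewrite mulnC divnK// bl// lt_eqF.
set n := (l %/ `|b j|)%N in lE *.
have -> : X ^+ l * \sum_(t < n) X ^ (b j *+ t)
    = X ^+ `|b j| * \sum_(t < n) X ^+ (`|b j| * t)%N.
  rewrite (reindex_inj rev_ord_inj) !mulr_sumr; apply: eq_bigr => t _ /=.
  rewrite -exprD !exprnP -expfzDr//; congr (_ ^ _); have := ltn_ord t => tn.
  have := congr1 (muln `|b j|) (subnKC tn).
  by rewrite mulrn_absz_lt0// {1}lE mulnDr mulnS; lia.
apply: (mulfI X1'); rewrite [X ^+ _ * _]mulrC -mulrA [X ^+ _ * _]mulrC down_denE//.
rewrite mulrCA /up_den -subrX1 /level -subrX1 mulrC.
rewrite [in RHS]lE exprM [RHS]subrX1; congr (_ * _); apply: eq_bigr => t _.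
by rewrite exprM.
Qed.

Lemma walk_value_pair c i j : i \in I -> j \in J ->
  walk_value c (pair_word i j) = X ^ c * level * pair_frac b X Y i j.
Proof.
move=> iI jJ; rewrite walk_value_cat pair_word_disp_left// !walk_value_nseq.
have bi : b i != 0 by move: iI; rewrite inE; lia.
have bj : b j != 0 by move: jJ; rewrite inE; lia.
rewrite /pair_frac mulrDr; congr (_ + _).
  rewrite -(level_up_den iI) -!mulrA; congr (_ * (_ * _)).
  by rewrite mulrCA divff ?mulr1// up_den_neq0.
rewrite -(level_down_den jJ) expfzDr// -!mulrA; congr (_ * (_ * (_ * _))).
by rewrite mulrCA divff ?mulr1// down_den_neq0.
Qed.

(** The loops realizing one monomial. A letter [k] is read once at each of l consecutive positions,
    so that its value carries the same factor [level] as that of a pair. *)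
Definition gadget (x : A * A + A) : seq (int * seq A) :=
  match x with
  | inl p => [:: (0, pair_word p.1 p.2)]
  | inr k => [seq (s%:Z, [:: k]) | s <- iota 0 l]
  end.

Definition gadget_frac (x : A * A + A) : F :=
  match x with inl p => pair_frac b X Y p.1 p.2 | inr k => Y k end.

Definition gadget_index (S : {set A * A}) (x : A * A + A) : bool :=
  match x with inl p => p \in S | inr k => k \in K end.

Variable S : {set A * A}.
Hypothesis SIJ : double_full I J S.

Let S_pos p : p \in S -> p.1 \in I.
Proof. by case: SIJ => /subsetP sub _ _ /sub; rewrite inE => /andP[]. Qed.

Let S_neg p : p \in S -> p.2 \in J.
Proof. by case: SIJ => /subsetP sub _ _ /sub; rewrite inE => /andP[]. Qed.

Lemma gadget_value c x : gadget_index S x ->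
  \sum_(g <- gadget x) walk_value (c + g.1) g.2 = X ^ c * level * gadget_frac x.
Proof.
case: x => [p pS|k _] /=.
  by rewrite big_seq1 /= addr0 walk_value_pair ?S_pos ?S_neg.
rewrite big_map (_ : iota 0 l = index_iota 0 l) ?/index_iota ?subn0//.
rewrite -{1}[l]subn0 big_mkord /level mulr_sumr mulr_suml.
apply: eq_bigr => s _; rewrite walk_value_cons walk_value_nil addr0.
by rewrite expfzDr.
Qed.

Lemma gadget_closed x g : gadget_index S x -> g \in gadget x -> disp b g.2 = 0.
Proof.
case: x => [p pS|k kK] /=.
  by rewrite inE => /eqP-> /=; rewrite pair_word_disp ?S_pos ?S_neg.
move=> /mapP[s _ ->] /=; rewrite disp_cons disp_nil addr0.
by apply/eqP; move: kK; rewrite /= inE.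
Qed.

(** An entry (x, c) of [m] stands for a monomial X^c in the polynomial attached to x. The exponents
    of pairs range over [p, q] with both ends attained, and [m_zero] is the form taken by the degree
    conditions. *)
Variables (m : seq ((A * A + A) * int)) (p q : int).
Hypothesis m_index : forall x, x \in m -> gadget_index S x.1.
Hypothesis m_pair : forall r c, (inl r, c) \in m -> p <= c <= q.
Hypothesis m_zero : forall k c, (inr k, c) \in m -> p <= c <= q + 1.
Hypothesis m_low : exists r, (inl r, p) \in m.
Hypothesis m_high : exists r, (inl r, q) \in m.
Hypothesis m_full_pair : forall r, r \in S -> exists c, (inl r, c) \in m.
Hypothesis m_full_zero : forall k, k \in K -> exists c, (inr k, c) \in m.
Hypothesis m_sum : \sum_(x <- m) X ^ x.2 * gadget_frac x.1 = 0.
Hypothesis l_large : q - p <= l%:Z.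
Hypothesis b_gcd : step b = 1%N.

Let pq : p <= q. Proof. by case: m_low => r /m_pair; lia. Qed.

(** With this choice the interval [q, p + N] has length 3l, enough for [itv_shift_biggcd] with bound
    l and for the shifts in [V_all]. *)
Let N : nat := (`|q - p| + 3 * l)%N.

(** Translating every gadget by s = 0, ..., N realizes the multiplication of the relation by 1 + X +
    ... + X^N. *)
Definition loop_list : seq (int * seq A) :=
  [seq (y.1.2 + y.2%:Z + g.1, g.2)
     | y <- [seq (x, s) | x <- m, s <- iota 0 N.+1], g <- gadget y.1.1].

Lemma loop_listP x s g : x \in m -> (s <= N)%N -> g \in gadget x.1 ->
  (x.2 + s%:Z + g.1, g.2) \in loop_list.
Proof.
move=> xm sN gx; apply/allpairsPdep; exists (x, s), g; split=> //.
apply/allpairsP; exists (x, s); split=> //.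
by rewrite mem_iota.
Qed.

Lemma loop_listE L : L \in loop_list -> exists x s g,
  [/\ x \in m, (s <= N)%N, g \in gadget x.1 & L = (x.2 + s%:Z + g.1, g.2)].
Proof.
case/allpairsPdep => -[x s] [g [/allpairsP[[x' s'] [xm + [-> ->]]]]].
by rewrite mem_iota => sN /= gx ->; exists x', s', g.
Qed.

Lemma loop_list_value : \sum_(L <- loop_list) walk_value L.1 L.2 = 0.
Proof.
rewrite big_allpairs_dep big_allpairs_dep.
transitivity (\sum_(x <- m) X ^ x.2 * gadget_frac x.1
    * (level * \sum_(s <- iota 0 N.+1) X ^ s%:Z)); last first.
  by rewrite -mulr_suml m_sum mul0r.
rewrite [LHS]big_seq [RHS]big_seq; apply: eq_bigr => x xm.
rewrite !mulr_sumr; apply: eq_bigr => s _.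
by rewrite gadget_value ?m_index// expfzDr//; ring.
Qed.

Section Connected.
Variable V : pred int.
Hypothesis Vq : V q.
Hypothesis Vloop : forall L, L \in loop_list ->
  {in loop_vertices b L &, forall c c', V c -> V c'}.

Let Vloop_eq L c c' : L \in loop_list ->
  c \in loop_vertices b L -> c' \in loop_vertices b L -> V c = V c'.
Proof. by move=> LL cL c'L; apply/idP/idP; exact: (Vloop LL). Qed.

Let pair_loop r c0 c : (inl r, c0) \in m -> c0 <= c <= c0 + N%:Z ->
  (c, pair_word r.1 r.2) \in loop_list.
Proof.
move=> rm c0c; have := @loop_listP _ (absz (c - c0)) (0, pair_word r.1 r.2) rm.
rewrite /= inE eqxx addr0; have -> : c0 + (absz (c - c0))%:Z = c by lia.
by apply; lia.
Qed.

Let quot_gt0 a : b a != 0 -> (0 < l %/ `|b a|)%N.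
Proof. by move=> ba; rewrite divn_gt0 ?absz_gt0// dvdn_leq// bl. Qed.

(** These are the start, the top, the end of the first letter [i] and the start of the last letter
    [j]. *)
Let pair_word_vertices c i j : i \in I -> j \in J ->
  let vs := loop_vertices b (c, pair_word i j) in
  [/\ c \in vs, c + l%:Z \in vs, c + `|b i|%N%:Z \in vs & c + `|b j|%N%:Z \in vs].
Proof.
move=> iI jJ /=; have bi : b i > 0 by rewrite inE in iI.
have bj : b j < 0 by rewrite inE in jJ.
have li := pair_word_disp_left iI; have lj := pair_word_disp_right jJ.
have := pair_word_disp iI jJ; rewrite /pair_word.
move: li lj; have := quot_gt0 (lt0r_neq0 bi); have := quot_gt0 (ltr0_neq0 bj).
case: (l %/ `|b i|)%N => // n; case: (l %/ `|b j|)%N => // n' _ _ li lj lij.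
split.
- rewrite -[X in X \in _]addr0 -(disp_nil b).
  exact: (@mem_loop_vertices _ b c [::]).
- by rewrite -li; exact: mem_loop_vertices.
- have -> : c + `|b i|%N%:Z = c + disp b [:: i] by rewrite disp_cons disp_nil; lia.
  case: n li lij => [|n] _ _; last exact: (@mem_loop_vertices _ b c [:: i]).
  exact: (@mem_loop_vertices _ b c [:: i]).
- rewrite -[n'.+1]addn1 nseqD /= catA.
  have -> : c + `|b j|%N%:Z = c + disp b (nseq n.+1 i ++ nseq n' j).
    by move: lij; rewrite !disp_cat /= [disp b (j :: _)]disp_cons; lia.
  exact: mem_loop_vertices.
Qed.

(** The translates of a pair at exponent p start everywhere in [p, p + N], those of a pair at q in
    [q, q + N]. The two ranges overlap and cover [p, q + N]. *)
Let V_level c : p <= c <= q + N%:Z -> V c = V (c + l%:Z).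
Proof.
move=> cpq; have [r [c0 [rm c0c]]] : exists r c0,
    (inl r, c0) \in m /\ c0 <= c <= c0 + N%:Z.
  have [[r rm] [r' rm']] := (m_low, m_high).
  have [cN|cN] := leP c (p + N%:Z); first by exists r, p; split=> //; lia.
  by exists r', q; split=> //; rewrite /N in cN *; lia.
have rS : r \in S := m_index rm.
have [v1 v2 _ _] := pair_word_vertices c (S_pos rS) (S_neg rS).
exact: Vloop_eq (pair_loop rm c0c) v1 v2.
Qed.

(** From q to p + N, the translates of every pair of [S] are available, whatever its exponent in
    [p, q]. Double-fullness provides a pair containing [a]. *)
Let V_step a c : b a != 0 -> q <= c -> c + `|b a|%N%:Z <= p + N%:Z ->
  V c = V (c + `|b a|%N%:Z).
Proof.
move=> ba qc cp; have [r rS ra] : exists2 r, r \in S & r.1 = a \/ r.2 = a.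
  have [_ fI fJ] := SIJ; move: ba; rewrite neq_lt => /orP[] ba.
    by have [|i _ ijS] := fJ a; [rewrite inE|exists (i, a) => //; right].
  by have [|j _ ijS] := fI a; [rewrite inE|exists (a, j) => //; left].
have [c0 rm] := m_full_pair rS; have c0pq := m_pair rm.
have [v1 _ v3 v4] := pair_word_vertices c (S_pos rS) (S_neg rS).
have Lr : (c, pair_word r.1 r.2) \in loop_list by apply: pair_loop rm _; lia.
by case: ra => <-; [exact: Vloop_eq Lr v1 v3|exact: Vloop_eq Lr v1 v4].
Qed.

(** The shifts by the step lengths, whose gcd is 1, combine to a shift by 1, which spreads [V] from
    q over the interval. *)
Let V_middle c : q <= c <= p + N%:Z -> V c.
Proof.
have V1 : itv_shift_invariant V q (p + N%:Z) 1.
  rewrite -[1%N]b_gcd; apply: (@itv_shift_biggcd _ _ _ _ _ _ l).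
    by rewrite /N; lia.
  move=> a; rewrite !inE => aIJ; have ba : b a != 0 by lia.
  split; first by rewrite dvdn_leq// bl.
  by move=> c0 qc cp; apply: V_step.
move=> cqp; have -> : c = q + (absz (c - q))%:Z by lia.
have : q + (absz (c - q))%:Z <= p + N%:Z by lia.
elim: (absz _) => [|n IH] nN; first by rewrite addr0.
have -> : q + n.+1%:Z = q + n%:Z + 1%N%:Z by lia.
by rewrite -V1 ?IH//; lia.
Qed.

(** Outside the middle interval, one or two shifts by l lead back into it because q - p is at most
    l. *)
Let V_all c : p <= c <= q + N%:Z + l%:Z -> V c.
Proof.
move=> cpq; have [cq|qc] := ltP c q.
  by rewrite V_level ?V_middle//; rewrite /N; lia.
have [cN|Nc] := leP c (p + N%:Z); first by rewrite V_middle//; lia.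
have [clN|Nlc] := leP (c - l%:Z) (p + N%:Z).
  rewrite -[c](subrK l%:Z) -V_level ?V_middle//; move: Nc clN; rewrite /N; lia.
rewrite -[c](subrK l%:Z) -V_level; last by move: Nc Nlc; rewrite /N; lia.
rewrite -[c - l%:Z](subrK l%:Z) -V_level ?V_middle//; move: Nc Nlc; rewrite /N; lia.
Qed.

Lemma loop_list_connected L : L \in loop_list -> has V (loop_vertices b L).
Proof.
case/loop_listE => -[[r|k] c] [s [g [xm sN /= gx ->]]].
  have rS : r \in S := m_index xm; have c0 := m_pair xm.
  move: gx; rewrite inE => /eqP -> /=; rewrite addr0.
  have [v1 _ _ _] := pair_word_vertices (c + s%:Z) (S_pos rS) (S_neg rS).
  by apply/hasP; exists (c + s%:Z) => //; apply: V_all; lia.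
(* The position is at most (q + 1) + N + (l - 1), just the upper end allowed in [V_all]: this is
   where the 1 in condition (ii) fits. *)
have c0 := m_zero xm; case/mapP: gx => t; rewrite mem_iota => tl -> /=.
by rewrite orbF; apply: V_all; lia.
Qed.

End Connected.

Lemma loops_walk : exists w,
  [/\ disp b w = 0, forall a, a \in w & walk_value 0 w = 0].
Proof.
have [L|V Vq Vl|w [w0 Pw]] := @merge_loops _ b loop_list q.
- case/loop_listE => x [s [g [xm _ gx ->]]].
  exact: gadget_closed (m_index xm) gx.
- by move=> L LL; exact: (loop_list_connected Vq Vl).
exists w; split=> //; last first.
  (* The merged walk starts at q. Reading it from 0 only changes its value by a power of X. *)
  have : walk_value q w = 0.
    rewrite /walk_value (perm_big _ Pw) /= big_flatten big_map.
    exact: loop_list_value.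
  rewrite walk_value_shift => /eqP.
  by rewrite mulf_eq0 expfz_eq0 (negPf X0) andbF => /eqP.
move=> a; rewrite -(map_snd_walk b q w) (perm_mem (perm_map snd Pw)).
have [L LL aL] : exists2 L, L \in loop_list & a \in L.2.
  have [aK|ba] := boolP (a \in K).
    have [c cm] := m_full_zero aK; exists (c + 0%N%:Z + 0%N%:Z, [:: a]).
      apply: (loop_listP cm (g := (0%N%:Z, [:: a]))) => //.
      by rewrite map_f// mem_iota.
    by rewrite inE eqxx.
  have {}ba : b a != 0 by rewrite inE in ba.
  have [r rS ra] : exists2 r, r \in S & r.1 = a \/ r.2 = a.
    have [_ fI fJ] := SIJ; move: ba; rewrite neq_lt => /orP[] ba.
      by have [|i _ ijS] := fJ a; [rewrite inE|exists (i, a) => //; right].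
    by have [|j _ ijS] := fI a; [rewrite inE|exists (a, j) => //; left].
  have [c cm] := m_full_pair rS; exists (c + 0%N%:Z + 0, pair_word r.1 r.2).
    by apply: (loop_listP cm (g := (0, pair_word r.1 r.2))) => //; rewrite inE.
  rewrite mem_cat !mem_nseq; case: ra => raE; rewrite raE eqxx andbT.
    by rewrite divn_gt0 ?absz_gt0// dvdn_leq// bl.
  by rewrite orbC divn_gt0 ?absz_gt0// dvdn_leq// bl.
rewrite map_flatten; apply/flattenP; exists L.2 => //.
by apply/mapP; exists (loop_walk b L); rewrite ?map_f// map_snd_walk.
Qed.

End LoopsToWalk.

(** * Semigroups that are groups *)

Section SemigroupGroup.
Variables (T : groupType) (A : finType) (g : A -> T).
Local Open Scope group_scope.
Local Notation H := (semigroup_gen (fun x => x \in codom g)).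

Lemma semigroup_gen_word x :
  H x <-> exists2 w : seq A, w != [::] & x = \prod_(a <- w) g a.
Proof.
split=> [[s [s0 sG ->]]|[w w0 ->]]; last first.
  exists (map g w); rewrite big_map; split=> //; first by case: w w0.
  by move=> _ /mapP[a _ ->]; exact: codom_f.
have [w sE] : exists w, s = map g w.
  elim: s sG {s0} => [|c s IH] sG; first by exists [::].
  have [|w ->] := IH; first by move=> z zs; apply: sG; rewrite inE zs orbT.
  have /codomP[a ->] : c \in codom g by apply: sG; rewrite inE eqxx.
  by exists (a :: w).
exists w; last by rewrite sE big_map.
by move: s0; rewrite sE; case: (w).
Qed.

(** In a group the idempotent [e] is 1, and the words a v_a with v_a an inverse of a concatenate to
    a word containing all letters. Conversely, deleting one occurrence of a letter from such a word
    and rotating the rest gives an inverse of the letter. *)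
Lemma semigroup_is_group_iff (a0 : A) :
  is_group H <-> exists2 w : seq A, forall a, a \in w & \prod_(a <- w) g a = 1.
Proof.
split=> [[e He Hg]|[w full w1]].
  have e1 : e = 1.
    by have [ee _ _] := Hg e He; apply: (@mulgI _ e); rewrite ee mulg1.
  have inv a : exists w : seq A, g a * \prod_(c <- w) g c = 1.
    have Ha : H (g a) by apply/semigroup_gen_word; exists [:: a]; rewrite ?big_seq1.
    have [_ _ [z /semigroup_gen_word[w _ ->] [az _]]] := Hg _ Ha.
    by exists w; rewrite az e1.
  have [v vE] := fin_all_exists inv.
  exists (flatten [seq a :: v a | a <- enum A]) => [a|].
    apply/flattenP; exists (a :: v a); last by rewrite inE eqxx.
    by apply: map_f; rewrite mem_enum.
  rewrite big_flatten big_map big1_seq// => a _.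
  by rewrite big_cons; exact: vE.
have H1 : H 1.
  apply/semigroup_gen_word; exists w; last by rewrite w1.
  by have := full a0; case: (w).
have HM x z : H x -> H z -> H (x * z).
  move=> /semigroup_gen_word[u u0 ->] /semigroup_gen_word[v _ ->].
  apply/semigroup_gen_word; exists (u ++ v); last by rewrite big_cat.
  by case: (u) u0.
exists 1 => // x /semigroup_gen_word[u _ ->]; rewrite mul1g mulg1; split=> //.
suff [z Hz uz] : exists2 z, H z & \prod_(a <- u) g a * z = 1.
  by exists z => //; split=> //; rewrite -(mulg1_eq uz) mulVg.
elim: u => [|a u [z Hz uz]]; first by exists 1; rewrite // big_nil mulg1.
have [u1 [u2 wE]] : exists u1 u2, w = u1 ++ a :: u2.
  by have /splitPr[u1 u2] := full a; exists u1, u2.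
(* The product over [u2 ++ u1] inverts [g a]. Appending [w], of product 1, keeps the word
   non-empty. *)
exists (z * \prod_(c <- (u2 ++ u1) ++ w) g c).
  apply: HM Hz _; apply/semigroup_gen_word; eexists; last by [].
  by rewrite -size_eq0 size_cat wE !size_cat /= !addnS.
rewrite big_cons big_cat /= w1 mulg1 -mulgA (mulgA _ z) uz mul1g.
move: w1; rewrite wE !big_cat big_cons /= => w1.
by rewrite mulgA -(mulg1_eq w1) mulVg.
Qed.

End SemigroupGroup.

(** * Degrees and supports *)

Lemma bigmax_int_seq (s : seq int) : s != [::] ->
  exists q, [/\ q \in s, forall c, c \in s -> c <= q
    & \big[Order.max/-oo%E]_(k <- s) k%:E%E = q%:E%E].
Proof.
elim: s => // a s IH _; have [->|s0] := eqVneq s [::].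
  exists a; rewrite big_seq1 inE; split=> // c; by rewrite inE => /eqP ->.
have [q [qs qmax qE]] := IH s0; rewrite big_cons qE -EFin_max.
exists (Num.max a q); split=> // [|c].
  by rewrite inE; case: leP; rewrite ?eqxx ?qs ?orbT.
by rewrite inE le_max => /predU1P[->|/qmax ->]; rewrite ?lexx ?orbT.
Qed.

Lemma bigmin_int_seq (s : seq int) : s != [::] ->
  exists q, [/\ q \in s, forall c, c \in s -> q <= c
    & \big[Order.min/+oo%E]_(k <- s) k%:E%E = q%:E%E].
Proof.
elim: s => // a s IH _; have [->|s0] := eqVneq s [::].
  exists a; rewrite big_seq1 inE; split=> // c; by rewrite inE => /eqP ->.
have [q [qs qmin qE]] := IH s0; rewrite big_cons qE -EFin_min.
exists (Num.min a q); split=> // [|c].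
  by rewrite inE; case: leP; rewrite ?eqxx ?qs ?orbT.
by rewrite inE ge_min => /predU1P[->|/qmin ->]; rewrite ?lexx ?orbT.
Qed.

Lemma enum_msupp_neq0 (R : zmodType) (f : laurent R) :
  f != 0 -> enum_fset (msupp f) != [::].
Proof.
move=> f0; apply: contraNneq f0 => e; apply/eqP/malgP => c; rewrite mcoeff0.
apply: mcoeff_outdom; apply/negP => cf.
by have : c \in enum_fset (msupp f) := cf; rewrite e.
Qed.

Lemma deg_plusP (R : zmodType) (f : laurent R) : f != 0 ->
  exists q, [/\ q \in msupp f, forall c, c \in msupp f -> c <= q
    & deg_plus f = q%:E%E].
Proof.
by move/enum_msupp_neq0; exact: bigmax_int_seq.
Qed.

Lemma deg_minusP (R : zmodType) (f : laurent R) : f != 0 ->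
  exists q, [/\ q \in msupp f, forall c, c \in msupp f -> q <= c
    & deg_minus f = q%:E%E].
Proof.
by move/enum_msupp_neq0; exact: bigmin_int_seq.
Qed.

Lemma deg_plus0 (R : zmodType) : deg_plus (0 : laurent R) = -oo%E.
Proof. by rewrite /deg_plus msupp0 big_nil. Qed.

Lemma deg_minus0 (R : zmodType) : deg_minus (0 : laurent R) = +oo%E.
Proof. by rewrite /deg_minus msupp0 big_nil. Qed.

Section NonnegSum.
Variables (R : realType) (T : finType) (P : {set T}) (f : T -> laurent R).
Hypothesis f0 : forall t, t \in P -> nonneg_laurent (f t).

Lemma nonneg_laurent_sum : nonneg_laurent (\sum_(t in P) f t).
Proof. by move=> c; rewrite raddf_sum sumr_ge0 // => t tP; exact: f0. Qed.

(** Non-negative coefficients cannot cancel. *)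
Lemma msupp_nonneg_sum c :
  c \in msupp (\sum_(t in P) f t) <-> exists2 t, t \in P & c \in msupp (f t).
Proof.
rewrite -mcoeff_neq0 raddf_sum /= psumr_neq0 => [|t tP]; last exact: f0.
split=> [/hasP[t _ /andP[tP ft]]|[t tP ft]].
  by exists t; rewrite // -mcoeff_neq0 gt_eqF.
apply/hasP; exists t; rewrite ?mem_index_enum// tP lt_def f0// andbT.
by rewrite mcoeff_neq0.
Qed.

Lemma nonneg_laurent_sum_nz : P != set0 -> (forall t, t \in P -> f t != 0) ->
  nonneg_laurent_nz (\sum_(t in P) f t).
Proof.
case/set0Pn => t tP /(_ t tP) /deg_plusP[c [ct _ _]].
split; first exact: nonneg_laurent_sum.
have : c \in msupp (\sum_(t in P) f t) by apply/msupp_nonneg_sum; exists t.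
by apply: contraTneq => ->; rewrite msupp0.
Qed.

End NonnegSum.

(** * Integral multiplicities from a real relation *)

Notation const_frac R := (@tofrac {poly R} \o polyC).

(** Every monomial in a support counts as a separate unknown with a positive value.
    [pos_nat_relation] makes these values positive integers, the multiplicities in [m], and so
    preserves the supports. *)
Lemma laurent_relation_multiset (R : realType) (L : finType) (f : L -> laurent R)
    (G : L -> {fraction {poly rat}}) (X : {fraction {poly rat}}) :
  (forall t, nonneg_laurent (f t)) ->
  \sum_t leval (const_frac R) (embQR R X) (f t) * embQR R (G t) = 0 ->
  exists m : seq (L * int), (forall x, (x \in m) = (x.2 \in msupp (f x.1)))
    /\ \sum_(x <- m) embQR R X ^ x.2 * embQR R (G x.1) = 0.
Proof.
move=> f0 fG0.
pose s : seq (L * int) := [seq (t, c) | t <- enum L, c <- msupp (f t)].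
have sE x : (x \in s) = (x.2 \in msupp (f x.1)).
  apply/allpairsPdep/idP => [[t [c [_ cf ->]]]//|xf].
  by exists x.1, x.2; rewrite mem_enum; split=> //; case: (x).
have us : uniq s.
  apply: allpairs_uniq_dep; [exact: enum_uniq|by move=> t _; exact: fset_uniq|].
  by move=> [t c] [t' c'] _ _ [-> ->].
have sumE (V : nmodType) (H : L * int -> V) :
    \sum_(x : seq_sub s) H (val x) = \sum_(x <- s) H x.
  rewrite -(big_map val xpredT H); apply/perm_big/uniq_perm => //.
    by rewrite map_inj_uniq ?index_enum_uniq//; exact: val_inj.
  move=> x; apply/mapP/idP => [[y _ ->]|xs]; first exact: valP.
  by exists (SeqSub xs); rewrite ?mem_index_enum.
have r0 (x : seq_sub s) : 0 < (f (val x).1)@_(val x).2.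
  by rewrite lt_def f0 andbT mcoeff_neq0 -sE; exact: valP.
have [|k k0 kE] := pos_nat_relation (u := fun x : seq_sub s =>
    X ^ (val x).2 * G (val x).1) r0.
  rewrite (sumE _ (fun x => tofrac ((f x.1)@_x.2)%:P * embQR R (X ^ x.2 * G x.1))).
  rewrite big_allpairs_dep big_enum /= -[RHS]fG0; apply: eq_bigr => t _.
  rewrite /leval mmapE mulr_suml; apply: eq_bigr => c _ /=.
  by rewrite embQRE rmorphM fmorphXz mulrA.
exists (flatten [seq nseq (k x) (val x) | x <- enum {: seq_sub s}]); split=> [x|].
  rewrite -sE; apply/flattenP/idP => [[_ /mapP[z _ ->]]|xs].
    by rewrite mem_nseq => /andP[_ /eqP ->]; exact: valP.
  exists (nseq (k (SeqSub xs)) x); last by rewrite mem_nseq eqxx k0.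
  by apply/mapP; exists (SeqSub xs); rewrite // mem_enum.
rewrite big_flatten big_map big_enum -[RHS]kE; apply: eq_bigr => x _ /=.
rewrite big_nseq embQRE rmorphM fmorphXz -embQRE.
by rewrite -[LHS]/(iter _ (+%R _) 0) iter_addr_0 mulr_natl.
Qed.

(** * Components modulo d and substitution of X^d *)

Section Bridge.
Variables (R : realType) (d : nat).
Hypothesis d0 : (0 < d)%N.

Local Notation x := (@fracX R).
Local Notation subst := (frac_morph (comp_polyXn_inj (R := R) d0)).

Lemma subst_laurent_frac (f : laurent R) :
  subst (laurent_frac f) = leval (const_frac R) (x ^+ d) f.
Proof.
rewrite /frac_morph frac_map_laurent; last exact: comp_polyXn_inj.
rewrite /leval !mmapE; apply: eq_bigr => c _ /=.
by rewrite comp_polyC comp_polyX tofracXn.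
Qed.

Lemma subst_embQR u : subst (embQR R u) = embQR R (frac_subst d u).
Proof.
rewrite /frac_morph /embQR /frac_subst.
rewrite (frac_map_comp (@map_poly_ratr_inj R) (comp_polyXn_inj d0)).
rewrite (frac_map_comp (comp_polyXn_inj d0) (@map_poly_ratr_inj R)).
apply: eq_frac_map => p /=; rewrite map_comp_poly map_polyXn.
by [].
Qed.

Lemma subst_decomp (f : laurent R) u (v : nat -> {fraction {poly rat}}) :
  u = \sum_(m < d) frac_subst d (v m) * fracX ^+ m ->
  \sum_(m < d) subst (laurent_frac f * embQR R (v m)) * x ^+ m
  = leval (const_frac R) (x ^+ d) f * embQR R u.
Proof.
move=> ->; rewrite embQRE rmorph_sum mulr_sumr; apply: eq_bigr => m _.
rewrite rmorphM /= subst_laurent_frac -embQRE subst_embQR -mulrA; congr (_ * _).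
rewrite embQRE [RHS]rmorphM; congr (_ * _).
by apply/esym; exact: embQR_fracXn.
Qed.

End Bridge.

(** * Words in the wreath product *)

Lemma fracX_expn_neq1 (R : idomainType) n :
  (0 < n)%N -> (fracX : {fraction {poly R}}) ^+ n != 1.
Proof.
move=> n0; rewrite /fracX -tofracXn -tofrac1 tofrac_eq.
apply/eqP => /(congr1 (fun p : {poly R} => size p)).
by rewrite size_polyXn size_poly1; lia.
Qed.

Section Scaling.
Variables (A : finType) (b : A -> int).

Definition scaled (a : A) : int := (b a %/ (step b)%:Z)%Z.

Lemma step_dvd a : ((step b)%:Z %| b a)%Z.
Proof.
have [->|ba] := eqVneq (b a) 0; first exact: dvdz0.
rewrite dvdzE /= /step (bigD1 a) ?dvdn_gcdl//= !inE.
by rewrite -neq_lt eq_sym.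
Qed.

Lemma scaledE a : b a = scaled a * (step b)%:Z.
Proof. by rewrite /scaled divzK// step_dvd. Qed.

Hypothesis I0 : idx_pos b != set0.

Lemma step_gt0 : (0 < step b)%N.
Proof.
case/set0Pn: I0 => i; rewrite inE => bi; rewrite lt0n.
by apply: contraTneq bi => d0; rewrite scaledE d0 mulr0 ltxx.
Qed.

Let d0 : 0 < (step b)%:Z.
Proof. exact: step_gt0. Qed.

Lemma idx_pos_scaled : idx_pos scaled = idx_pos b.
Proof. by apply/setP => a; rewrite !inE [b a]scaledE pmulr_lgt0. Qed.

Lemma idx_neg_scaled : idx_neg scaled = idx_neg b.
Proof. by apply/setP => a; rewrite !inE [b a]scaledE pmulr_llt0. Qed.

Lemma idx_zero_scaled : idx_zero scaled = idx_zero b.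
Proof.
by apply/setP => a; rewrite !inE [b a]scaledE mulf_eq0 (gt_eqF d0) orbF.
Qed.

Lemma absz_scaled a : `|scaled a|%N = (`|b a| %/ step b)%N.
Proof. by rewrite [b a in RHS]scaledE abszM /= mulnK ?step_gt0. Qed.

Lemma step_scaled : step scaled = 1%N.
Proof.
apply/eqP; rewrite -(eqn_pmul2r step_gt0) mul1n {1}/step.
rewrite idx_pos_scaled idx_neg_scaled.
rewrite (big_morph (muln^~ (step b)) (fun m n => muln_gcdl m n (step b)) (mul0n _)).
apply/eqP/eq_bigr => a _.
by rewrite [b a in RHS]scaledE abszM.
Qed.

Lemma disp_scaled w : disp b w = disp scaled w * (step b)%:Z.
Proof. by rewrite /disp mulr_suml; apply: eq_bigr => a _; exact: scaledE. Qed.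

Lemma walk_value_scaled (F : fieldType) (X : F) (Y : A -> F) z w :
  walk_value b X Y (z * (step b)%:Z) w = walk_value scaled (X ^+ step b) Y z w.
Proof.
elim: w z => [|a w IH] z; first by rewrite !walk_value_nil.
rewrite !walk_value_cons -IH mulrDl -scaledE; congr (_ * _ + _).
by rewrite [X ^+ _]exprnP exprz_exp mulrC.
Qed.

End Scaling.

Section Wreath.
Variables (R : realType) (A : finType) (y : A -> laurent int) (b : A -> int).

Definition letter_frac (f : laurent int) : {fraction {poly R}} :=
  embQR R (embZQ (laurent_frac f)).

Lemma embZQE : embZQ = frac_morph map_poly_intr_inj.
Proof. by []. Qed.

Lemma letter_frac_eq0 f : letter_frac f = 0 -> f = 0.
Proof.
rewrite /letter_frac embQRE embZQE => /eqP; rewrite !fmorph_eq0 => /eqP.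
exact: laurent_frac_eq0.
Qed.

Lemma letter_fracD f g : letter_frac (f + g) = letter_frac f + letter_frac g.
Proof.
rewrite /letter_frac embQRE embZQE.
have -> : laurent_frac (f + g) = laurent_frac f + laurent_frac g.
  exact: (raddfD (leval (const_frac int) fracX)).
by rewrite !rmorphD.
Qed.

Lemma letter_frac0 : letter_frac 0 = 0.
Proof. by apply: (addrI (letter_frac 0)); rewrite -letter_fracD !addr0. Qed.

Lemma letter_frac_shift n f :
  letter_frac (laurent_shift n f) = fracX ^ n * letter_frac f.
Proof.
rewrite /letter_frac.
have -> : laurent_frac (laurent_shift n f) = fracX ^ n * laurent_frac f.
  exact: (leval_shift (const_frac int) _ _ (fracX_neq0 _)).
rewrite embQRE embZQE [X in _ _ X = _]rmorphM rmorphM; congr (_ * _).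
rewrite [X in _ _ X = _]fmorphXz [LHS]fmorphXz; congr (_ ^ _).
have e1 : frac_morph map_poly_intr_inj fracX = fracX.
  by apply: etrans (frac_map_tofrac map_poly_intr_inj _) _; rewrite /= map_polyX.
rewrite [X in _ X = _]e1; apply: etrans (frac_map_tofrac (@map_poly_ratr_inj R) _) _.
by rewrite /= map_polyX.
Qed.

(** A letter read at position c adds X^c y_a to the first component, since the letters before it act
    on it by a shift. *)
Lemma wreath_prod w : let g := (\prod_(a <- w) wr_elt y b a)%g in
  g.2 = disp b w /\
  letter_frac g.1 = walk_value b fracX (fun a => letter_frac (y a)) 0 w.
Proof.
elim: w => [|a w [/= IH2 IH1]] /=.
  rewrite big_nil disp_nil walk_value_nil; split=> //.
  exact: letter_frac0.
rewrite big_cons disp_cons walk_value_cons -IH2; split=> //.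
rewrite [LHS]letter_fracD letter_frac_shift IH1 expr0z mul1r add0r.
by rewrite -walk_value_shift ?fracX_neq0.
Qed.

Lemma wreath_prod_eq1 w : (\prod_(a <- w) wr_elt y b a)%g = 1%g <->
  disp b w = 0 /\ walk_value b fracX (fun a => letter_frac (y a)) 0 w = 0.
Proof.
have [d2 d1] := wreath_prod w; split=> [g1|[w0 v0]].
  by rewrite -d2 -d1 g1; split=> //; exact: letter_frac0.
move: d2 d1; case: (\prod_(a <- w) _)%g => f e /= -> /=; rewrite v0 w0.
by move/letter_frac_eq0 => ->.
Qed.

End Wreath.

(** * The criterion for the wreath product *)

Section Main.
Variables (R : realType) (A : finType) (y : A -> laurent int) (b : A -> int).
Hypothesis I0 : idx_pos b != set0.

Local Notation d := (step b).
Local Notation I := (idx_pos b).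
Local Notation J := (idx_neg b).
Local Notation K := (idx_zero b).
Local Notation X := ((fracX : {fraction {poly R}}) ^+ d).
Local Notation Y := (fun a => letter_frac R (y a)).
Local Notation ev := (leval (const_frac R) X).
Local Notation hh := (pair_frac (scaled b) X Y).

Let d0 : (0 < d)%N := step_gt0 I0.

Let X0 : X != 0.
Proof. by rewrite expf_neq0 ?fracX_neq0. Qed.

Let X1 n : (0 < n)%N -> X ^+ n != 1.
Proof. by move=> n0; rewrite -exprM fracX_expn_neq1 ?muln_gt0 ?d0. Qed.

Lemma group_iff_closed_walk :
  is_group (semigroup_gen (fun x => x \in codom (wr_elt y b))) <->
  exists w, [/\ disp (scaled b) w = 0, forall a, a \in w
    & walk_value (scaled b) X Y 0 w = 0].
Proof.
have [a0 _] := set0Pn _ I0; rewrite (semigroup_is_group_iff _ a0).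
have dz w : disp b w = 0 <-> disp (scaled b) w = 0.
  rewrite disp_scaled; split=> [/eqP|->]; last by rewrite mul0r.
  by rewrite mulf_eq0 => /orP[/eqP//|]; rewrite eqz_nat gtn_eqF.
have vz w : walk_value b fracX Y 0 w = walk_value (scaled b) X Y 0 w.
  by rewrite -walk_value_scaled mul0r.
split=> [[w full /(wreath_prod_eq1 R)[w0 v0]]|[w [w0 full v0]]].
  by exists w; split=> //; [exact/dz|rewrite -vz].
by exists w => //; apply/(wreath_prod_eq1 R); rewrite vz; split=> //; exact/dz.
Qed.

Lemma embQR_hfrac i j : embQR R (hfrac y b i j) = hh i j.
Proof.
have eD := rmorphD (frac_morph (@map_poly_ratr_inj R)).
have eV := fmorph_div (frac_morph (@map_poly_ratr_inj R)).
have eS := rmorph_sum (frac_morph (@map_poly_ratr_inj R)).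
rewrite embQRE [LHS]eD; congr (_ + _).
  rewrite [LHS]eV; congr (_ / _).
  rewrite [LHS]eS /up_den absz_scaled// big_mkord; apply: eq_bigr => s _.
  by apply: etrans (embQR_fracXn _ _) _; rewrite mulnC exprM.
rewrite [LHS]eV; congr (_ / _).
rewrite [LHS]eS /down_den absz_scaled// big_add1 /= big_mkord.
apply: eq_bigr => s _.
apply: etrans (fmorphV _ _) _; congr (_^-1).
by apply: etrans (embQR_fracXn _ _) _; rewrite mulnC exprM.
Qed.

Section Decomposition.
Variables (h : A -> A -> nat -> {fraction {poly rat}})
  (yK : A -> nat -> laurent rat).
Hypothesis h_decomp : forall i j, i \in I -> j \in J ->
  hfrac y b i j = \sum_(m < d) frac_subst d (h i j m) * fracX ^+ m.
Hypothesis yK_decomp : forall k, k \in K ->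
  embZQ (laurent_frac (y k))
  = \sum_(m < d) frac_subst d (laurent_frac (yK k m)) * fracX ^+ m.

(** The equations in (i), with X^d substituted and weighted by X^m, add up to the single equation by
    [subst_decomp]. They can be recovered from it by the uniqueness in [frac_decomp0]. *)
Lemma system_iff (S : {set A * A}) (fIJ : A * A -> laurent R) (f : A -> laurent R) :
  S \subset setX I J ->
  (forall m : nat, (m < d)%N ->
     \sum_(p in S) laurent_frac (fIJ p) * embQR R (h p.1 p.2 m)
     + \sum_(k in K) laurent_frac (f k) * embQR R (laurent_frac (yK k m)) = 0)
  <-> \sum_(p in S) ev (fIJ p) * hh p.1 p.2 + \sum_(k in K) ev (f k) * Y k = 0.
Proof.
move=> /subsetP SIJ; pose E (m : nat) :=
  \sum_(p in S) laurent_frac (fIJ p) * embQR R (h p.1 p.2 m)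
  + \sum_(k in K) laurent_frac (f k) * embQR R (laurent_frac (yK k m)).
rewrite -/(forall m : nat, (m < d)%N -> E m = 0).
pose sg := frac_morph (comp_polyXn_inj (R := R) d0).
have sgD u v : sg (u + v) = sg u + sg v by exact: rmorphD.
have sg_sum (T : finType) (P : {set T}) G :
  sg (\sum_(t in P) G t) = \sum_(t in P) sg (G t) by exact: rmorph_sum.
have EE : \sum_(m < d) sg (E m) * fracX ^+ m =
    \sum_(p in S) ev (fIJ p) * hh p.1 p.2 + \sum_(k in K) ev (f k) * Y k.
  transitivity (\sum_(m < d)
     (\sum_(p in S) sg (laurent_frac (fIJ p) * embQR R (h p.1 p.2 m)) * fracX ^+ m
      + \sum_(k in K) sg (laurent_frac (f k) * embQR R (laurent_frac (yK k m)))
          * fracX ^+ m)).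
    apply: eq_bigr => m _.
    by rewrite /E sgD !sg_sum mulrDl !mulr_suml.
  rewrite big_split /= exchange_big [X in _ + X]exchange_big /=; congr (_ + _).
    apply: eq_bigr => p /SIJ; rewrite inE => /andP[pI pJ].
    by rewrite (subst_decomp d0 _ (h_decomp pI pJ)) embQR_hfrac.
  by apply: eq_bigr => k kK; 
  exact: (subst_decomp d0 (f k) (v := fun m => laurent_frac (yK k m))
    (yK_decomp kK)).
rewrite -EE; split=> [E0|].
  by rewrite big1// => m _; rewrite E0// /sg rmorph0 mul0r.
by move/(frac_decomp0 d0).
Qed.

End Decomposition.

Lemma group_iff_laurents : J != set0 ->
  is_group (semigroup_gen (fun x => x \in codom (wr_elt y b)))
  <->
  exists (S : {set A * A}) (fIJ : A * A -> laurent R) (f : A -> laurent R),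
    [/\ double_full I J S,
        forall p, p \in S -> nonneg_laurent_nz (fIJ p),
        forall k, k \in K -> nonneg_laurent_nz (f k),
        \sum_(p in S) ev (fIJ p) * hh p.1 p.2 + \sum_(k in K) ev (f k) * Y k = 0
      & forall c, c \in msupp (\sum_(k in K) f k) ->
          (exists2 e, e \in msupp (\sum_(p in S) fIJ p) & c <= e + 1)
          /\ (exists2 e, e \in msupp (\sum_(p in S) fIJ p) & e <= c)].
Proof.
move=> J0; rewrite group_iff_closed_walk.
have [eI eJ] := (idx_pos_scaled I0, idx_neg_scaled I0).
have eK := idx_zero_scaled I0.
split=> [[w [w0 full v0]]|[S [fIJ [f [dS fS fK E0 deg]]]]].
  rewrite -eI -eJ -eK.
  by apply: (closed_walk_laurents _ X0 X1 w0 full _ v0); rewrite eI.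
(* The polynomials are extended by 0 outside [S] and [K], where they thus contribute no monomial to
   the multiset. *)
pose ff (x : A * A + A) : laurent R := match x with
  | inl p => if p \in S then fIJ p else 0
  | inr k => if k \in K then f k else 0 end.
pose G (x : A * A + A) := match x with
  | inl p => hfrac y b p.1 p.2 | inr k => embZQ (laurent_frac (y k)) end.
have XQ : embQR R (fracX ^+ d) = X := embQR_fracXn R d.
have GE x : embQR R (G x) = gadget_frac (scaled b) X Y x.
  by case: x => [p|k] //=; exact: embQR_hfrac.
have [||m [mE m0]] := @laurent_relation_multiset R _ ff G (fracX ^+ d).
- case=> [p|k] /=; case: ifP => [xS|_] c; rewrite ?mcoeff0//.
    by have [+ _] := fS _ xS; apply.
  by have [+ _] := fK _ xS; apply.
- rewrite XQ big_sumType /= -[RHS]E0; congr (_ + _).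
    rewrite [RHS]big_mkcond; apply: eq_bigr => p _ /=.
    by case: ifP => _; rewrite ?raddf0 ?mul0r// embQR_hfrac.
  rewrite [RHS]big_mkcond; apply: eq_bigr => k _ /=.
  by case: ifP => _; rewrite ?raddf0 ?mul0r.
have mem_pair p c : (inl p, c) \in m = (p \in S) && (c \in msupp (fIJ p)).
  by rewrite mE /=; case: ifP => //; rewrite msupp0.
have mem_zero k c : (inr k, c) \in m = (k \in K) && (c \in msupp (f k)).
  by rewrite mE /=; case: ifP => //; rewrite msupp0.
have fS_supp := msupp_nonneg_sum (fun p pS => (fS p pS).1).
have fK_supp := msupp_nonneg_sum (fun k kK => (fK k kK).1).
have S0 : S != set0.
  have [_ fI _] := dS; have [i iI] := set0Pn _ I0.
  by have [j _ ijS] := fI i iI; apply/set0Pn; exists (i, j).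
have [_ sum0] := nonneg_laurent_sum_nz (fun p pS => (fS p pS).1) S0
  (fun p pS => (fS p pS).2).
have [q [qS qmax _]] := deg_plusP sum0; have [p [pS pmin _]] := deg_minusP sum0.
(* The product is a common multiple of the step lengths, and the first factor makes l exceed q -
   p. *)
pose l := (`|q - p|.+1 * \prod_(a | scaled b a != 0) `|scaled b a|)%N.
have P0 : (0 < \prod_(a | scaled b a != 0) `|scaled b a|)%N.
  by rewrite prodn_cond_gt0// => a; rewrite absz_gt0.
have m_pair r c : (inl r, c) \in m -> p <= c <= q.
  rewrite mem_pair => /andP[rS cr].
  have cS : c \in msupp (\sum_(p in S) fIJ p) by apply/fS_supp; exists r.
  by rewrite pmin ?qmax.
apply: (@loops_walk _ (scaled b) _ X Y X0 X1 l _ _ S _ m p q) => //.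
- by rewrite muln_gt0.
- by move=> a ba; rewrite dvdn_mull// (bigD1 a)//= dvdn_mulr.
- by rewrite eI eJ.
- case=> -[r|k] c; rewrite ?mem_pair ?mem_zero => /andP[]//=.
  by rewrite eK.
- move=> k c; rewrite mem_zero => /andP[kK ck].
  have [|[e eS ce] [e' e'S ec]] := deg c; first by apply/fK_supp; exists k.
  by rewrite (le_trans (pmin _ e'S) ec) (le_trans ce)// lerD2r qmax.
- have [r rS pr] := (fS_supp p).1 pS.
  by exists r; rewrite mem_pair rS.
- have [r rS pr] := (fS_supp q).1 qS.
  by exists r; rewrite mem_pair rS.
- move=> r rS; have [_ /deg_plusP[c [cr _ _]]] := fS r rS.
  by exists c; rewrite mem_pair rS.
- move=> k; rewrite eK => kK; have [_ /deg_plusP[c [ck _ _]]] := fK k kK.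
  by exists c; rewrite mem_zero kK.
- by rewrite -[RHS]m0 XQ; apply: eq_bigr => x _; rewrite GE.
- have : (`|q - p| <= l)%N
    by rewrite /l mulSn (leq_trans _ (leq_addl _ _))// leq_pmulr.
  by move: l => l'; lia.
- exact: step_scaled.
Qed.

End Main.

(** Extremal exponents belong to the supports, so comparing them amounts to comparing elements. For
    [f = 0], as happens when K is empty, the infinite degrees match the empty quantification. *)
Lemma deg_condition (R : zmodType) (f g : laurent R) : g != 0 ->
  (deg_plus f <= deg_plus g + 1)%E /\ (deg_minus g <= deg_minus f)%E <->
  forall c, c \in msupp f ->
    (exists2 e, e \in msupp g & c <= e + 1) /\ (exists2 e, e \in msupp g & e <= c).
Proof.
move=> g0; have [q [qg qmax ->]] := deg_plusP g0.
have [p [pg pmin ->]] := deg_minusP g0.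
have [->|f0] := eqVneq f 0.
  rewrite deg_plus0 deg_minus0 leNye leey; split=> // _ c; by rewrite msupp0.
have [q' [q'f q'max ->]] := deg_plusP f0; have [p' [p'f p'min ->]] := deg_minusP f0.
rewrite -EFinD !lee_fin; split=> [[qq pp] c cf|H].
  by split; [exists q|exists p] => //; [have := q'max c cf|have := p'min c cf]; lia.
have [[e eg qe] _] := H q' q'f; have [_ [e' e'g pe]] := H p' p'f.
by have := qmax e eg; have := pmin e' e'g; lia.
Qed.

Theorem corollary3p3 (R : realType) (A : finType)
    (y : A -> laurent int) (b : A -> int)
    (h : A -> A -> nat -> {fraction {poly rat}})
    (yK : A -> nat -> laurent rat) :
  let I := idx_pos b in
  let J := idx_neg b in
  let K := idx_zero b in
  let d := step b in
  I != set0 -> J != set0 ->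
  (forall i j, i \in I -> j \in J ->
     hfrac y b i j = \sum_(m < d) frac_subst d (h i j m) * fracX ^+ m) ->
  (forall k, k \in K ->
     embZQ (laurent_frac (y k))
     = \sum_(m < d) frac_subst d (laurent_frac (yK k m)) * fracX ^+ m) ->
  is_group (semigroup_gen (fun x => x \in codom (wr_elt y b)))
  <->
  exists (S : {set A * A}) (fS fK : laurent R)
         (fIJ : A * A -> laurent R) (f : A -> laurent R),
    [/\ double_full I J S,
        [/\ nonneg_laurent_nz fS,
            nonneg_laurent fK /\ (K != set0 -> nonneg_laurent_nz fK),
            forall p, p \in S -> nonneg_laurent_nz (fIJ p)
          & forall k, k \in K -> nonneg_laurent_nz (f k)],
        [/\ forall m : nat, (m < d)%N ->
              \sum_(p in S) laurent_frac (fIJ p) * embQR R (h p.1 p.2 m)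
              + \sum_(k in K)
                  laurent_frac (f k) * embQR R (laurent_frac (yK k m)) = 0,
            fS = \sum_(p in S) fIJ p
          & fK = \sum_(k in K) f k],
        (deg_plus fK <= deg_plus fS + 1)%E
      & (deg_minus fS <= deg_minus fK)%E].
Proof.
move=> I J K d I0 J0 hE yE; rewrite (group_iff_laurents R y I0 J0).
split=> [[S [fIJ [f [dS fS fK E0 deg]]]]|
    [S [fS [fK [fIJ [f [dS [fS0 fK0 fIJ0 f0] [E0 fSE fKE] degp degm]]]]]]].
  have [SIJ fI _] := dS.
  (* As I is non-empty, so is [S], which makes f_S non-zero as [deg_condition] requires. *)
  have S0 : S != set0.
    have [i iI] := set0Pn _ I0; have [j _ ijS] := fI i iI.
    by apply/set0Pn; exists (i, j).
  have sS := nonneg_laurent_sum_nz (fun p pS => (fS p pS).1) S0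
    (fun p pS => (fS p pS).2).
  have [degp degm] := (deg_condition (\sum_(k in K) f k) sS.2).2 deg.
  exists S, (\sum_(p in S) fIJ p), (\sum_(k in K) f k), fIJ, f.
  split=> //; split=> //; last exact/(system_iff I0 hE yE).
  split=> [|K0]; first exact: nonneg_laurent_sum (fun k kK => (fK k kK).1).
  exact: nonneg_laurent_sum_nz (fun k kK => (fK k kK).1) K0
    (fun k kK => (fK k kK).2).
have [SIJ _ _] := dS; exists S, fIJ, f; split=> //.
  exact/(system_iff I0 hE yE fIJ f SIJ).
by rewrite -fKE -fSE; apply/deg_condition => //; case: fS0.
Qed.
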